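(* Let $M>1$ be a constant. Suppose we observe i.i.d. $p$-variate Gaussian random vectors $X^{(1)},\dots,X^{(n)}$ with zero mean and precision matrix $\Omega=(\omega_{kl})_{p\times p}\in\mathcal G_0(M,k_{n,p})$. Assume that $p\ge k_{n,p}^{\nu}$ with some $\nu>2$, and that $3\le k_{n,p}\le C_0\,n/\log p$ for some $C_0>0$. Then, for each $(i,j)$, the following minimax lower bounds hold: $$\inf_{\hat\omega_{ij}}\ \sup_{\mathcal G_0(M,k_{n,p})}\mathbb P\Big\{|\hat\omega_{ij}-\omega_{ij}|>\max\Big\{C_1\frac{k_{n,p}\log p}{n},\ C_2\sqrt{\frac1n}\Big\}\Big\}>c_1>0$$ and $$\inf_{\hat\Omega}\ \sup_{\mathcal G_0(M,k_{n,p})}\mathbb P\Big\{\|\hat\Omega-\Omega\|_\infty>\max\Big\{C_1'\frac{k_{n,p}\log p}{n},\ C_2'\sqrt{\frac{\log p}{n}}\Big\}\Big\}>c_2>0,$$ where $c_1,c_2,C_1,C_2,C_1',C_2'$ are positive constants depending on $M$, $\nu$ and $C_0$ only, and the infima are over all estimators based on the data.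
   Context: $\mathcal G_0(M,k_{n,p})$ is the set of $p\times p$ symmetric positive definite matrices $\Omega=(\omega_{ij})$ with $\max_{1\le j\le p}\sum_{i=1}^p1\{\omega_{ij}\ne0\}\le k_{n,p}$ and $1/M\le\lambda_{\min}(\Omega)\le\lambda_{\max}(\Omega)\le M$. $\|\cdot\|_\infty$ of a matrix is the maximum absolute entry. *)

(* Defs.v *)
From HB Require Import structures.
From mathcomp Require Import all_boot all_order all_algebra.
From mathcomp Require Import all_classical all_reals all_analysis.
From mathcomp Require Import measurable_realfun ring.
Set Implicit Arguments.
Unset Strict Implicit.
Unset Printing Implicit Defensive.
Import Order.TTheory GRing.Theory Num.Theory.
Import numFieldNormedType.Exports.
Local Open Scope classical_set_scope.
Local Open Scope ring_scope.

(* The Borel sets of R are carried by measurableTypeR R in the type of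
   lebesgue_measure, so all sample spaces below are tuples over
   measurableTypeR R. *)

Section tcons_measure.
Local Open Scope ereal_scope.
Context d (T : measurableType d) (R : realType) (n : nat).
Variables (mu : {sigma_finite_measure set T -> \bar R})
  (nu : {sigma_finite_measure set (n.-tuple T) -> \bar R}).

Definition tcons (z : T * n.-tuple T) : n.+1.-tuple T := [tuple of z.1 :: z.2].

Definition tuncons (t : n.+1.-tuple T) : T * n.-tuple T :=
  (thead t, [tuple of behead t]).

Lemma tconsK : cancel tcons tuncons.
Proof.
by case=> x t; rewrite /tuncons /tcons/=; congr pair; exact/val_inj.
Qed.

Lemma tconsP (t : n.+1.-tuple T) : exists x t', t = tcons (x, t').
Proof.
exists (thead t), [tuple of behead t]; rewrite [LHS]tuple_eta; exact/val_inj.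
Qed.

Lemma measurable_tcons : measurable_fun [set: T * n.-tuple T] tcons.
Proof. exact: measurable_cons. Qed.

Lemma measurable_tuncons : measurable_fun [set: n.+1.-tuple T] tuncons.
Proof.
apply/measurable_fun_pair; first exact: measurable_tnth.
exact: measurable_behead.
Qed.

HB.instance Definition _ := isMeasurableFun.Build _ _ _ _ tcons measurable_tcons.

Definition tcons_measure : set (n.+1.-tuple T) -> \bar R :=
  pushforward (mu \x nu) tcons.

Let tcons_measure0 : tcons_measure set0 = 0.
Proof. exact: measure0. Qed.

Let tcons_measure_ge0 A : 0 <= tcons_measure A.
Proof. exact: measure_ge0. Qed.

Let tcons_measure_sigma_additive : semi_sigma_additive tcons_measure.
Proof. exact: measure_semi_sigma_additive. Qed.

HB.instance Definition _ := isMeasure.Build _ _ _ tcons_measure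
  tcons_measure0 tcons_measure_ge0 tcons_measure_sigma_additive.

Let tcons_measure_sigma_finite : sigma_finite setT tcons_measure.
Proof.
have /sigma_finiteP[F [TF ndF Foo]] := sigma_finiteT mu.
have /sigma_finiteP[G [TG ndG Goo]] := sigma_finiteT nu.
exists (fun k => tuncons @^-1` (F k `*` G k)).
  apply/esym/seteqP; split=> // t _; have [x [t' ->]] := tconsP t.
  have [i _ Fx] : (\bigcup_i F i) x by rewrite -TF.
  have [j _ Gt] : (\bigcup_i G i) t' by rewrite -TG.
  exists (maxn i j) => //; rewrite /preimage [X in X _]/mkset tconsK; split=> /=.
  - by move: Fx; exact/subsetPset/ndF/leq_maxl.
  - by move: Gt; exact/subsetPset/ndG/leq_maxr.
move=> k; have [mF Fk] := Foo k; have [mG Gk] := Goo k; split.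
  rewrite -[X in measurable X]setTI.
  by apply: measurable_tuncons => //; exact: measurableX.
rewrite /tcons_measure /pushforward -comp_preimage.
rewrite (_ : _ \o _ = id) ?preimage_id; last exact/funext/tconsK.
by rewrite product_measure1E// lte_mul_pinfty// ge0_fin_numE.
Qed.

HB.instance Definition _ :=
  @Measure_isSigmaFinite.Build _ _ _ tcons_measure tcons_measure_sigma_finite.

End tcons_measure.

(* n-fold product measure mu (x) ... (x) mu on n.-tuple T. *)
Section power_measure.
Local Open Scope ereal_scope.
Context d (T : measurableType d) (R : realType).
Variable mu : {sigma_finite_measure set T -> \bar R}.

Fixpoint power_measure_rec (n : nat) :
    {sigma_finite_measure set (n.-tuple T) -> \bar R} :=
  if n is m.+1 then tcons_measure mu (power_measure_rec m)
  else @dirac _ (0.-tuple T) [tuple] R.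

Definition power_measure n : set (n.-tuple T) -> \bar R := power_measure_rec n.

Arguments power_measure n : clear implicits.

HB.instance Definition _ n := SigmaFiniteMeasure.on (power_measure n).

End power_measure.
Arguments power_measure {d T R} mu n _.

Section power_probability.
Local Open Scope ereal_scope.
Context d (T : measurableType d) (R : realType) (P : probability T R).

Let power_measure_setT n : power_measure P n [set: n.-tuple T] = 1.
Proof.
elim: n => [|n IHn]; first by rewrite /power_measure/= diracT.
rewrite /power_measure/= /tcons_measure /pushforward preimage_setT.
rewrite -setXTT product_measure1E//.
by rewrite -[X in _ * X]/(power_measure P n setT) IHn mule1; exact: probability_setT.
Qed.

HB.instance Definition _ n := Measure_isProbability.Build _ _ _
  (power_measure P n) (power_measure_setT n).

End power_probability.

Section posdef.
Variable R : realType.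

Definition qform p (A : 'M[R]_p) (v : 'rV[R]_p) : R := (v *m A *m v^T) 0 0.

Definition posdef p (A : 'M[R]_p) : Prop :=
  A^T = A /\ forall v : 'rV[R]_p, v != 0 -> 0 < qform A v.

(* Schur complement of the top left entry *)
Definition schur p (A : 'M[R]_(1 + p)) : 'M[R]_p :=
  drsubmx A - (A 0 0)^-1 *: (dlsubmx A *m ursubmx A).

Lemma posdef_diag_gt0 p (A : 'M[R]_p) i : posdef A -> 0 < A i i.
Proof.
move=> [_ A_gt0].
have : delta_mx 0 i != 0 :> 'rV[R]_p.
  apply/eqP => /matrixP/(_ 0 i); rewrite !mxE !eqxx/= => /eqP.
  by rewrite oner_eq0.
move=> /A_gt0; rewrite /qform -rowE mxE (bigD1 i)//= !mxE !eqxx mulr1.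
by rewrite big1 ?addr0// => j ji; rewrite !mxE (negbTE ji) mulr0.
Qed.

Lemma qform_schur p (A : 'M[R]_(1 + p)) (y : R) (v : 'rV[R]_p) :
  A^T = A -> A 0 0 != 0 ->
  qform A (row_mx y%:M v) =
  A 0 0 * (y - (- (A 0 0)^-1 * (v *m dlsubmx A) 0 0)) ^+ 2 + qform (schur A) v.
Proof.
move=> symA a0; set a := A 0 0.
have ulA : ulsubmx A = a%:M.
  apply/matrixP => i j; rewrite !ord1 !mxE eqxx mulr1n /a.
  by congr (A _ _); exact/val_inj.
have urA : ursubmx A = (dlsubmx A)^T by rewrite trmx_dlsub symA.
set c := dlsubmx A in urA *; set b := v *m c.
rewrite /qform /schur -{1}(submxK A) ulA urA -/c -/a.
rewrite mul_row_block tr_row_mx mul_row_col.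
rewrite mulmxDl -!mul_scalar_mx.
have vb : v *m c *m (y%:M)^T = (y * b 0 0)%:M.
  rewrite tr_scalar_mx -/b [b]mx11_scalar -scalar_mxM mulrC.
  by rewrite [in RHS]mxE eqxx mulr1n.
have bv : y%:M *m c^T *m v^T = (y * b 0 0)%:M.
  rewrite -mulmxA -trmx_mul -/b [b]mx11_scalar tr_scalar_mx -scalar_mxM.
  by rewrite [in RHS]mxE eqxx mulr1n.
rewrite vb mulmxDl bv mulmxBr mulmxBl tr_scalar_mx -!scalar_mxM.
have -> : v *m (a^-1%:M *m (c *m c^T)) *m v^T = (a^-1 * (b 0 0) ^+ 2)%:M.
  rewrite mul_scalar_mx -scalemxAr -scalemxAl mulmxA -/b -mulmxA -trmx_mul -/b.
  rewrite [b]mx11_scalar tr_scalar_mx -scalar_mxM scale_scalar_mx expr2.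
  by rewrite [in RHS]mxE eqxx mulr1n.
move: (v *m drsubmx A *m v^T) (b 0 0) => q s; rewrite !mxE eqxx !mulr1n.
by field.
Qed.

Lemma det_schur p (A : 'M[R]_(1 + p)) :
  A 0 0 != 0 -> \det A = A 0 0 * \det (schur A).
Proof.
move=> a0; set a := A 0 0 in a0 *.
have ulA : ulsubmx A = a%:M.
  apply/matrixP => i j; rewrite !ord1 !mxE eqxx mulr1n /a.
  by congr (A _ _); exact/val_inj.
pose L : 'M[R]_(1 + p) := block_mx 1%:M 0 (a^-1 *: dlsubmx A) 1%:M.
pose U : 'M[R]_(1 + p) := block_mx a%:M (ursubmx A) 0 (schur A).
have LU : A = L *m U.
  rewrite mulmx_block !mul1mx !mul0mx !addr0 -scalemxAl mul_mx_scalar.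
  rewrite scalerA mulVf// scale1r -scalemxAl /schur -/a addrC subrK -ulA.
  by rewrite submxK.
by rewrite {1}LU det_mulmx det_lblock !det1 !mul1r det_ublock det_scalar1.
Qed.

Lemma posdef_schur p (A : 'M[R]_(1 + p)) : posdef A -> posdef (schur A).
Proof.
move=> pA; have a0 : A 0 0 != 0 by rewrite gt_eqF// posdef_diag_gt0.
have [symA A_gt0] := pA; split.
  rewrite /schur linearB/= linearZ/= trmx_mul trmx_drsub trmx_ursub trmx_dlsub.
  by rewrite symA.
move=> v v0.
have /A_gt0 : row_mx (- (A 0 0)^-1 * (v *m dlsubmx A) 0 0)%:M v != 0.
  by apply: contra v0 => /eqP; rewrite -row_mx0 => /eq_row_mx[_ ->].
by rewrite qform_schur// subrr expr0n/= mulr0 add0r.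
Qed.

Lemma posdef_det_gt0 p (A : 'M[R]_p) : posdef A -> 0 < \det A.
Proof.
elim: p A => [|p IHp] A pA; first by rewrite det_mx00.
rewrite (@det_schur p) ?gt_eqF ?posdef_diag_gt0// mulr_gt0 ?posdef_diag_gt0//.
exact/IHp/(@posdef_schur p).
Qed.

End posdef.

Section gaussian.
Variable R : realType.
Local Notation mR := (measurableTypeR R).
Local Notation mu := (@lebesgue_measure R).

Record posdefmx (p : nat) := PosDefMx {
  posdefmx_val :> 'M[R]_p ;
  posdefmxP : posdef posdefmx_val }.

Definition lebesgue_measure_tuple (p : nat) : set (p.-tuple mR) -> \bar R :=
  power_measure mu p.
Arguments lebesgue_measure_tuple p _ : clear implicits.

HB.instance Definition _ p := SigmaFiniteMeasure.on (lebesgue_measure_tuple p).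

(* Lebesgue density of N(0, Omega^-1): Omega is the precision, not the
   covariance. *)
Definition gaussian_pdf p (Omega : 'M[R]_p) (x : p.-tuple mR) : R :=
  Num.sqrt (\det Omega / (2 * pi) ^+ p)
    * expR (- qform Omega (\row_j tnth x j) / 2).

Lemma gaussian_pdf_ge0 p (Omega : 'M[R]_p) x : 0 <= gaussian_pdf Omega x.
Proof. by rewrite mulr_ge0 ?sqrtr_ge0 ?expR_ge0. Qed.

Lemma measurable_gaussian_pdf p (Omega : 'M[R]_p) :
  measurable_fun setT (gaussian_pdf Omega).
Proof.
apply: measurable_funM => //; apply: measurableT_comp => //.
apply: measurable_funM => //; apply: measurableT_comp => //.
rewrite (_ : (fun x => _) = fun x : p.-tuple mR =>
  \sum_(j < p) (\sum_(i < p) (tnth x i : R) * Omega i j) * (tnth x j : R)).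
  apply: measurable_sum => j; apply: measurable_funM => //; last first.
    exact: measurable_tnth.
  apply: measurable_sum => i; apply: measurable_funM => //.
  exact: measurable_tnth.
apply/funext => x; rewrite /qform mxE; apply: eq_bigr => j _.
by rewrite !mxE; congr (_ * _); apply: eq_bigr => i _; rewrite !mxE.
Qed.

Lemma row_tcons p (y : mR) (t : p.-tuple mR) :
  \row_(j < p.+1) (tnth (tcons (y, t)) j : R) =
  row_mx (y : R)%:M (\row_j (tnth t j : R)) :> 'rV_(1 + p).
Proof.
apply/rowP => j; rewrite mxE; case: (@split_ordP 1 p j) => k ->.
  by rewrite row_mxEl !ord1 mxE eqxx mulr1n (tnth_nth y).
by rewrite row_mxEr mxE !(tnth_nth y).
Qed.

Lemma gaussian_pdf_tcons p (A : 'M[R]_p.+1) (y : mR) (t : p.-tuple mR) :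
  posdef A ->
  gaussian_pdf A (tcons (y, t)) =
  gaussian_pdf (@schur R p A) t *
  normal_pdf (- (A 0 0)^-1 * ((\row_j (tnth t j : R)) *m @dlsubmx R 1 p 1 p A) 0 0)
    (Num.sqrt (A 0 0))^-1 y.
Proof.
move=> pA; have a_gt0 := posdef_diag_gt0 0 pA.
have a0 : A 0 0 != 0 by rewrite gt_eqF.
rewrite /gaussian_pdf row_tcons (@qform_schur R p)//; last by case: pA.
rewrite (@det_schur R p A)// normal_pdfE; last first.
  by rewrite invr_eq0 gt_eqF// sqrtr_gt0.
set m := - (A 0 0)^-1 * _; set S := schur _; set v := \row_j _.
have det_gt0 : 0 < \det S by exact/posdef_det_gt0/posdef_schur.
rewrite /normal_peak /normal_fun.
have pi0 := pi_gt0 R.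
have s2 : (Num.sqrt (A 0 0))^-1 ^+ 2 = (A 0 0)^-1.
  by rewrite exprVn sqr_sqrtr// ltW.
rewrite s2 -sqrtrV; last by rewrite mulrn_wge0// mulr_ge0 ?invr_ge0 ?ltW.
rewrite mulrACA -sqrtrM; last first.
  by rewrite divr_ge0 ?exprn_ge0 ?mulr_ge0// ltW.
rewrite -expRD; congr (Num.sqrt _ * expR _).
  move: (@pi R) pi0 => q q0; rewrite exprS -mulr_natr; field.
  by rewrite a0 !gt_eqF//= exprn_gt0// mulr_gt0// mulr_gt0.
by rewrite -mulr_natr; field.
Qed.

Lemma integral_gaussian_pdf p (A : 'M[R]_p) : posdef A ->
  (\int[lebesgue_measure_tuple p]_x (gaussian_pdf A x)%:E = 1)%E.
Proof.
elim: p A => [|p IHp] A pA.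
  rewrite [LHS]integral_dirac//.
    by rewrite diracT mul1e /gaussian_pdf det_mx00 expr0 divr1 sqrtr1 mul1r
      /qform mxE big_ord0 oppr0 mul0r expR0.
  apply/measurable_EFinP; exact (measurable_gaussian_pdf _).
rewrite [LHS]ge0_integral_pushforward//; first last.
- by move=> x _; rewrite lee_fin gaussian_pdf_ge0.
- apply/measurable_EFinP; exact (measurable_gaussian_pdf _).
rewrite preimage_setT [LHS]fubini_tonelli2//; first last.
- by move=> x; rewrite lee_fin gaussian_pdf_ge0.
- apply/measurable_EFinP; apply: measurableT_comp; last exact: measurable_tcons.
  exact (measurable_gaussian_pdf _).
rewrite -[RHS](IHp _ (@posdef_schur R p A pA)); apply: eq_integral => t _.
rewrite /fubini_G/=.
under eq_integral do rewrite gaussian_pdf_tcons// EFinM.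
rewrite ge0_integralZl//; first last.
- by rewrite lee_fin gaussian_pdf_ge0.
- by move=> y _; rewrite lee_fin normal_pdf_ge0.
- by have /integrableP[] := integrable_normal_pdf
    (- (A 0 0)^-1 * ((\row_j (tnth t j : R)) *m @dlsubmx R 1 p 1 p A) 0 0)
    (Num.sqrt (A 0 0))^-1.
by rewrite integral_normal_pdf mule1.
Qed.

Definition gaussian_prob p (Omega : posdefmx p) : set (p.-tuple mR) -> \bar R :=
  fun V => (\int[lebesgue_measure_tuple p]_(x in V) (gaussian_pdf Omega x)%:E)%E.

Section gaussian_probability.
Variables (p : nat) (Omega : posdefmx p).

Let gaussian_prob0 : gaussian_prob Omega set0 = 0%E.
Proof. by rewrite /gaussian_prob integral_set0. Qed.

Let gaussian_prob_ge0 A : (0 <= gaussian_prob Omega A)%E.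
Proof. by apply: integral_ge0 => x _; rewrite lee_fin gaussian_pdf_ge0. Qed.

Let gaussian_prob_sigma_additive : semi_sigma_additive (gaussian_prob Omega).
Proof.
move=> F mF tF mUF.
rewrite /gaussian_prob ge0_integral_bigcup//; last first.
- by move=> x _; rewrite lee_fin gaussian_pdf_ge0.
- apply: measurable_funTS; apply/measurable_EFinP.
  exact (measurable_gaussian_pdf _).
by apply: is_cvg_nneseries => n _ _; exact: gaussian_prob_ge0.
Qed.

HB.instance Definition _ := isMeasure.Build _ _ _ (gaussian_prob Omega)
  gaussian_prob0 gaussian_prob_ge0 gaussian_prob_sigma_additive.

Let gaussian_prob_setT : gaussian_prob Omega [set: _] = 1%E.
Proof. exact/integral_gaussian_pdf/posdefmxP. Qed.

HB.instance Definition _ := @Measure_isProbability.Build _ _ R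
  (gaussian_prob Omega) gaussian_prob_setT.

End gaussian_probability.

(* All eigenvalues of a symmetric matrix are real, so the sets below are the
   full spectrum; it is finite and nonempty as soon as p > 0. *)
Definition lambda_min p (A : 'M[R]_p) : R := inf [set a | eigenvalue A a].
Definition lambda_max p (A : 'M[R]_p) : R := sup [set a | eigenvalue A a].

Definition G0 (p : nat) (M : R) (k : nat) : set (posdefmx p) :=
  [set Omega : posdefmx p |
    [/\ (\max_(j < p) \sum_(i < p) (Omega i j != 0%R) <= k)%N,
        M^-1 <= lambda_min Omega,
        lambda_min Omega <= lambda_max Omega &
        lambda_max Omega <= M]].

(* Joint law of n i.i.d. N(0, Omega^-1) vectors; component i of the tuple is
   the i-th observation. *)
Definition sample_prob (n p : nat) (Omega : posdefmx p) :
    probability (n.-tuple (p.-tuple mR)) R :=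
  power_measure (gaussian_prob Omega) n.

Definition entry_estimator (n p : nat) := {mfun n.-tuple (p.-tuple mR) >-> R}.

(* 'M[R]_p has no sigma-algebra in the library; measurability of a
   matrix-valued map is measurability of all its entries. *)
Definition matrix_estimator (n p : nat) :
    set (n.-tuple (p.-tuple mR) -> 'M[R]_p) :=
  [set d | forall i j, measurable_fun setT (fun x => d x i j)].

End gaussian.
Arguments G0 {R} p M k _.
Arguments sample_prob {R} n {p} Omega.
Arguments entry_estimator R n p : clear implicits.
Arguments matrix_estimator R n p _ : clear implicits.

(* Main.v *)
(* Le Cam's method with a mixture alternative: if the average of
   int f_m f_m' / f_0 over pairs (m, m') is at most K, then no test between
   f_0 and the uniform mixture of the f_m has both errors below a constant
   depending on K, whence a lower bound on the risk as soon as the loss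
   separates every f_m from f_0.  For centered Gaussians with precisions A, B
   and 1 this integral is sqrt (det A det B / det (A + B - 1)), and it
   tensorizes over the sample.

   Rate k log p / n for the entry (i, j): with u the indicator of {i, j} and v
   that of a set S disjoint from {i, j}, take
     Omega_S = (1 + a u^T v) (1 + a v^T u), a^2 ~ log p / n, |S| ~ k,
   whose (i, j) entry exceeds that of 1 by a^2 |S|.  Here det Omega_S = 1 and
   det (Omega_S + Omega_S' - 1) = 1 - 2 a^2 |S :&: S'| |u|^2, so the integral
   over the sample is at most a small power of p raised to |S :&: S'|; its
   average over (S, S') stays bounded because k^2 <= p^(2 / nu) and 2 / nu < 1.

   Rates sqrt (1 / n) and sqrt (log p / n): perturb 1 by a u^T u, respectively
   by a e_m^T e_m for a uniformly random m. *)
Require Import Defs.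
From HB Require Import structures.
From mathcomp Require Import all_boot all_order all_algebra.
From mathcomp Require Import all_classical all_reals all_analysis.
From mathcomp Require Import measurable_realfun ring lra zify.
Set Implicit Arguments.
Unset Strict Implicit.
Unset Printing Implicit Defensive.
Import Order.TTheory GRing.Theory Num.Theory.
Import numFieldNormedType.Exports.
Local Open Scope classical_set_scope.
Local Open Scope ring_scope.

(** * Densities of product measures *)

Section density.
Local Open Scope ereal_scope.
Context d (T : measurableType d) (R : realType).
Variables (mu nu : {measure set T -> \bar R}) (g : T -> R).
Hypotheses (mg : measurable_fun setT g) (g0 : forall x, (0 <= g x)%R).
Hypothesis nuE : forall A, measurable A -> nu A = \int[mu]_(x in A) (g x)%:E.

Import HBNNSimple.

Let integral_density_nnsfun (h : {nnsfun T >-> R}) :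
  \int[nu]_x (h x)%:E = \int[mu]_x ((h x)%:E * (g x)%:E).
Proof.
under [LHS]eq_integral do rewrite fimfunE -fsumEFin//.
rewrite [LHS]ge0_integral_fsum//; last 2 first.
  - by move=> r; exact/measurable_EFinP/measurableT_comp.
  - by move=> n x _; rewrite EFinM nnfun_muleindic_ge0.
under [RHS]eq_integral.
  move=> x xD; rewrite fimfunE -fsumEFin// muleC ge0_mule_fsumr; last first.
    by move=> r; rewrite EFinM nnfun_muleindic_ge0.
  over.
rewrite [RHS]ge0_integral_fsum//; last 2 first.
  - move=> r; apply: emeasurable_funM; first exact/measurable_EFinP.
    exact/measurable_EFinP/measurableT_comp.
  - move=> n x _; apply: mule_ge0; first by rewrite lee_fin.
    by rewrite EFinM nnfun_muleindic_ge0.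
apply: eq_fsbigr => r _.
have mr : measurable (h @^-1` [set r]) by exact: measurable_sfunP.
rewrite integralZl_indic_nnsfun// integral_indic// setIT nuE//.
have [r0|r0] := leP 0%R r; last first.
  rewrite preimage_nnfun0// integral_set0 mule0.
  by under eq_integral do rewrite indic0 mulr0 mule0; rewrite integral0.
rewrite -ge0_integralZl//; first last.
- by move=> x _; rewrite lee_fin.
- exact/measurable_funTS/measurable_EFinP.
rewrite integral_mkcond; apply: eq_integral => x _.
by rewrite epatch_indic/= -!EFinM; congr EFin; ring.
Qed.

(** Change of measure. For simple functions it reduces to [nuE] on the level sets; monotone
    convergence carries it over to [f]. *)
Lemma ge0_integral_density (f : T -> \bar R) :
  measurable_fun setT f -> (forall x, 0 <= f x) ->
  \int[nu]_x f x = \int[mu]_x (f x * (g x)%:E).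
Proof.
move=> mf f0; pose f_ := nnsfun_approx measurableT mf.
transitivity (limn (fun n => \int[nu]_x (f_ n x)%:E)).
  rewrite -monotone_convergence//=.
  - apply: eq_integral => x /[!inE] xD; apply/esym/cvg_lim => //=.
    exact: cvg_nnsfun_approx.
  - by move=> n; exact/measurable_EFinP.
  - by move=> n x _; rewrite lee_fin.
  - by move=> x _ a b ab; rewrite lee_fin//; exact/lefP/nd_nnsfun_approx.
under eq_fun do rewrite integral_density_nnsfun.
rewrite -monotone_convergence//=.
- apply: eq_integral => x _; under eq_fun do rewrite muleC.
  rewrite limeMl//.
    rewrite muleC; congr (_ * _); apply/cvg_lim => //.
    exact: cvg_nnsfun_approx.
  apply/ereal_nondecreasing_is_cvgn => a b ab.
  by rewrite lee_fin; exact/lefP/nd_nnsfun_approx.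
- by move=> n; apply: emeasurable_funM; exact/measurable_EFinP.
- by move=> n x _; rewrite mule_ge0// lee_fin.
- move=> x _ a b ab; rewrite lee_wpmul2r ?lee_fin//.
  exact/lefP/nd_nnsfun_approx.
Qed.

End density.

Section power_density.
Local Open Scope ereal_scope.
Context d (T : measurableType d) (R : realType).
Variables (mu nu : {sigma_finite_measure set T -> \bar R}) (g : T -> R).
Hypotheses (mg : measurable_fun setT g) (g0 : forall x, (0 <= g x)%R).
Hypothesis nuE : forall A, measurable A -> nu A = \int[mu]_(x in A) (g x)%:E.

Definition power_density n (x : n.-tuple T) : R :=
  (\prod_(i < n) g (tnth x i))%R.

Lemma power_density_ge0 n (x : n.-tuple T) : (0 <= power_density x)%R.
Proof. by apply: prodr_ge0 => i _. Qed.

Lemma measurable_power_density n : measurable_fun setT (@power_density n).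
Proof.
apply: measurable_prod => i _; apply: measurableT_comp => //.
exact: measurable_tnth.
Qed.

Lemma power_density_tcons n x (t : n.-tuple T) :
  power_density (tcons (x, t)) = (g x * power_density t)%R.
Proof.
rewrite /power_density big_ord_recl; congr (g _ * _)%R.
by apply: eq_bigr => i _; congr g; rewrite !(tnth_nth x).
Qed.

(** Induction on [n]: both sides are split at the first coordinate, the right one by Tonelli. The
    induction hypothesis treats each section of the set, and [ge0_integral_density] turns the
    remaining integral over [nu] into one over [mu]. *)
Lemma power_measure_density n (A : set (n.-tuple T)) : measurable A ->
  power_measure nu n A = \int[power_measure mu n]_(x in A) (power_density x)%:E.
Proof.
elim: n A => [|n IHn] A mA.
  rewrite [RHS]integral_dirac//; last first.
    apply: measurable_funTS; apply/measurable_EFinP.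
    exact (@measurable_power_density _).
  by rewrite /power_density big_ord0 mule1.
pose f x := (power_density x * \1_A x)%:E.
have f0 x : 0 <= f x by rewrite lee_fin mulr_ge0// power_density_ge0.
have mf : measurable_fun setT f.
  apply/measurable_EFinP/measurable_funM => //.
  exact: measurable_power_density.
have -> : \int[power_measure mu n.+1]_(x in A) (power_density x)%:E =
    \int[power_measure mu n.+1]_x f x.
  by rewrite integral_mkcond epatch_indic.
pose h (z : T * n.-tuple T) := f (tcons z).
have mh : measurable_fun setT h.
  exact (measurableT_comp mf (@measurable_tcons _ T n)).
have h0 z : 0 <= h z by exact: f0.
rewrite [RHS]ge0_integral_pushforward// preimage_setT.
rewrite [RHS](@fubini_tonelli1 _ _ _ _ _ mu (power_measure mu n) h mh h0).
pose B := @tcons _ T n @^-1` A.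
have mB : measurable B.
  by rewrite -[B]setTI; apply: measurable_tcons.
have mxB x : measurable (xsection B x) by exact: measurable_xsection.
transitivity (\int[nu]_x
    \int[power_measure mu n]_(t in xsection B x) (power_density t)%:E).
  rewrite [LHS]/(product_measure1 _ _ B); apply: eq_integral => x _.
  exact (IHn _ (mxB x)).
pose k (z : T * n.-tuple T) := (power_density z.2 * \1_B z)%:E.
have mk : measurable_fun setT k.
  apply/measurable_EFinP/measurable_funM => //.
  apply: measurableT_comp => //; exact (@measurable_power_density _).
have k0 z : 0 <= k z by rewrite lee_fin mulr_ge0// power_density_ge0.
transitivity (\int[nu]_x fubini_F (power_measure mu n) k x).
  apply: eq_integral => x _; rewrite integral_mkcond epatch_indic.
  apply: eq_integral => t _ /=; rewrite /k EFinM; congr (_ * _%:E).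
  by rewrite !indicE mem_xsection.
rewrite (ge0_integral_density mg g0 nuE)//; last 2 first.
- exact: measurable_fun_fubini_tonelli_F.
- by move=> x; apply: integral_ge0 => t _; exact: k0.
apply: eq_integral => x _; rewrite /fubini_F muleC.
rewrite -ge0_integralZl//; last 2 first.
- apply: (measurableT_comp mk); exact: pair1_measurable.
- by rewrite lee_fin.
apply: eq_integral => t _; rewrite /h /f /k power_density_tcons -EFinM.
by rewrite mulrA.
Qed.

End power_density.
Arguments power_density {d T R} g {n} x.

(** * Le Cam's method *)

Section le_cam.
Local Open Scope ereal_scope.
Context d (X : measurableType d) (R : realType) (I : finType).
Variables (mu : {measure set X -> \bar R}).
Variables (P0 : probability X R) (P : I -> probability X R).
Variables (f0 : X -> R) (f : I -> X -> R) (g : I -> I -> X -> R).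
Variables (r : I -> I -> R) (K : R).
Hypotheses (mf0 : measurable_fun setT f0) (f0_ge0 : forall x, (0 <= f0 x)%R).
Hypotheses (mf : forall m, measurable_fun setT (f m))
  (f_ge0 : forall m x, (0 <= f m x)%R).
Hypotheses (mg : forall m m', measurable_fun setT (g m m'))
  (g_ge0 : forall m m' x, (0 <= g m m' x)%R).
Hypothesis P0E : forall A, measurable A -> P0 A = \int[mu]_(x in A) (f0 x)%:E.
Hypothesis PE : forall m A, measurable A ->
  P m A = \int[mu]_(x in A) (f m x)%:E.
Hypothesis gE : forall m m' x, (f m x * f m' x = g m m' x * f0 x)%R.
Hypothesis gr : forall m m', \int[mu]_x (g m m' x)%:E <= (r m m')%:E.
Hypotheses (K_gt0 : (0 < K)%R) (I_gt0 : (0 < #|I|)%N).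
Hypothesis rK : (\sum_(z : I * I) r z.1 z.2 <= K * #|I|%:R ^+ 2)%R.

Let N : R := #|I|%:R.
Let N_gt0 : (0 < N)%R. Proof. by rewrite ltr0n. Qed.

(** Here [g m m'] stands for f_m f_m' / f_0, specified through the product so that zeros of f_0
    cause no trouble. With [G] the sum of all [g m m'], the square of the sum of the f_m is
    [G * f0], so AM-GM bounds that sum by N K f_0 + G / (4 N K). The integral of [G] is at most K
    N^2, which turns the last term into N / 4. *)
Let mixture_le A : measurable A ->
  \sum_m P m A <= (N * K)%:E * P0 A + (N / 4)%:E.
Proof.
move=> mA.
have NK : (0 < N * K)%R by rewrite mulr_gt0.
pose G x : R := (\sum_(z : I * I) g z.1 z.2 x)%R.
have mG : measurable_fun setT G.
  by apply: measurable_sum => z; exact: mg.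
have G0 x : (0 <= G x)%R by apply: sumr_ge0.
have intG : \int[mu]_(x in A) (G x)%:E <= (K * N ^+ 2)%:E.
  apply: (@le_trans _ _ (\int[mu]_x (G x)%:E)).
    apply: ge0_subset_integral => //; first exact/measurable_EFinP.
    by move=> x _; rewrite lee_fin.
  under eq_integral do rewrite /G -sumEFin.
  rewrite ge0_integral_sum//; last 2 first.
  - by move=> z; exact/measurable_EFinP.
  - by move=> z x _; rewrite lee_fin.
  apply: (@le_trans _ _ (\sum_(z : I * I) (r z.1 z.2)%:E)).
    by apply: lee_sum => z _; exact: gr.
  by rewrite sumEFin lee_fin.
have -> : \sum_m P m A = \int[mu]_(x in A) (\sum_m f m x)%:E.
  under [RHS]eq_integral do rewrite -sumEFin.
  rewrite ge0_integral_sum//; last 2 first.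
  - by move=> m; exact/measurable_funTS/measurable_EFinP.
  - by move=> m x _; rewrite lee_fin.
  by apply: eq_bigr => m _; exact: PE.
apply: (@le_trans _ _ (\int[mu]_(x in A)
    ((N * K)%:E * (f0 x)%:E + ((4 * (N * K))^-1)%:E * (G x)%:E))).
  apply: ge0_le_integral => //.
  - by move=> x _; rewrite lee_fin sumr_ge0.
  - apply/measurable_funTS/measurable_EFinP.
    by apply: measurable_sum => m; exact: mf.
  - apply/measurable_funTS/emeasurable_funD; apply: measurable_funeM;
      exact/measurable_EFinP.
  move=> x _; rewrite -!EFinM -EFinD lee_fin.
  rewrite -ler_sqr ?nnegrE ?sumr_ge0//; last first.
    by rewrite addr_ge0// mulr_ge0 ?invr_ge0 ?mulr_ge0 ?f0_ge0 ?G0// ltW.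
  have -> : ((\sum_m f m x) ^+ 2 = G x * f0 x)%R.
    rewrite expr2 big_distrlr/= pair_bigA/= /G mulr_suml.
    by apply: eq_bigr => z _; rewrite gE.
  (* AM-GM: (a + b)^2 >= 4 a b *)
  have -> : (G x * f0 x = 4 * (N * K * f0 x) * ((4 * (N * K))^-1 * G x))%R.
    by field; rewrite !gt_eqF.
  set a := (_ * f0 x)%R; set b := (_ * G x)%R.
  by rewrite -subr_ge0 [leRHS](_ : _ = (a - b) ^+ 2)%R ?sqr_ge0//; ring.
rewrite ge0_integralD//; first last.
- by apply/measurable_funTS/measurable_funeM/measurable_EFinP.
- by move=> x _; rewrite -EFinM lee_fin mulr_ge0// invr_ge0 mulr_ge0// ltW.
- by apply/measurable_funTS/measurable_funeM/measurable_EFinP.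
- by move=> x _; rewrite -EFinM lee_fin mulr_ge0// ltW.
rewrite !ge0_integralZl_EFin//; first last.
- by rewrite ltW.
- exact/measurable_funTS/measurable_EFinP.
- by move=> x _; rewrite lee_fin.
- by rewrite invr_ge0 mulr_ge0// ltW.
- exact/measurable_funTS/measurable_EFinP.
- by move=> x _; rewrite lee_fin.
rewrite -P0E// leeD2l//.
apply: (@le_trans _ _ (((4 * (N * K))^-1)%:E * (K * N ^+ 2)%:E)).
  by rewrite lee_wpmul2l// lee_fin invr_ge0 mulr_ge0// ltW.
rewrite -EFinM lee_fin le_eqVlt; apply/orP; left; apply/eqP.
by field; rewrite !gt_eqF.
Qed.

(** If every error probability were below [c], the left side of [mixture_le] would be at least N (1
    - c) and its right side at most N K c + N / 4, which is smaller. *)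
Lemma le_cam A : measurable A ->
  (4 * (K + 1))^-1%:E <= P0 A \/ exists m, (4 * (K + 1))^-1%:E <= P m (~` A).
Proof.
move=> mA; set c := (_^-1)%R.
have K1 : (0 < K + 1)%R by rewrite addr_gt0.
apply: contrapT => /not_orP[/negP + /forallNP PA]; rewrite -ltNge => P0A.
have {}PA m : (P m (~` A) < c%:E) by rewrite ltNge; apply/negP/PA.
have := mixture_le mA; apply/negP; rewrite -ltNge.
apply: (@le_lt_trans _ _ ((N * K)%:E * c%:E + (N / 4)%:E)).
  by rewrite leeD2r// lee_wpmul2l ?lee_fin ?mulr_ge0// ltW.
rewrite -EFinM -EFinD.
apply: (@lt_le_trans _ _ (N * (1 - c))%:E).
  (* Since (K + 1) c = 1 / 4, the gap is N (1 - 1/4 - 1/4) = N / 2. *)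
  rewrite lte_fin -subr_gt0 [ltRHS](_ : _ = N / 2)%R ?divr_gt0//.
  by rewrite /c; field; rewrite gt_eqF.
have -> : (N * (1 - c))%:E = \sum_(m : I) (1 - c)%:E.
  by rewrite sumEFin sumr_const mulr_natl.
apply: lee_sum => m _; have -> : P m A = 1 - P m (~` A).
  by rewrite -probability_setC ?setCK//; exact: measurableC.
by rewrite EFinB leeB// ltW.
Qed.

End le_cam.

(** * Le Cam's method for samples of centered Gaussian vectors *)

Section gaussian_le_cam.
Variable R : realType.
Local Notation mR := (measurableTypeR R).

Lemma sample_prob_density n p (Omega : posdefmx R p)
    (A : set (n.-tuple (p.-tuple mR))) : measurable A ->
  sample_prob n Omega A =
  (\int[power_measure (@lebesgue_measure_tuple R p) n]_(x in A)
    (power_density (gaussian_pdf Omega) x)%:E)%E.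
Proof.
move=> mA; apply: power_measure_density => //.
- exact (measurable_gaussian_pdf _).
- by move=> x; exact: gaussian_pdf_ge0.
Qed.

(** The quadratic forms in the exponents satisfy A + B = (A + B - 1) + 1, so only the normalizing
    constants leave a factor. Positive definiteness of A + B - 1 makes the remaining factor a
    genuine Gaussian density, hence of integral 1. *)
Lemma gaussian_pdf_mul p (A B : 'M[R]_p) x :
  posdef A -> posdef B -> posdef (A + B - 1%:M) ->
  gaussian_pdf A x * gaussian_pdf B x =
  Num.sqrt (\det A * \det B / \det (A + B - 1%:M)) *
  gaussian_pdf (A + B - 1%:M) x * gaussian_pdf 1%:M x.
Proof.
move=> pA pB pC; have [a0 b0 c0] := And3 (posdef_det_gt0 pA)
  (posdef_det_gt0 pB) (posdef_det_gt0 pC).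
have pi0 : 0 < (2 * pi) ^+ p :> R by rewrite exprn_gt0// mulr_gt0// pi_gt0.
rewrite /gaussian_pdf det1; set v := \row_j _; set q := (2 * pi) ^+ p in pi0 *.
set C := A + B - 1%:M in c0 *.
have -> : Num.sqrt (\det A / q) * expR (- qform A v / 2) *
    (Num.sqrt (\det B / q) * expR (- qform B v / 2)) =
    (Num.sqrt (\det A / q) * Num.sqrt (\det B / q)) *
    (expR (- qform A v / 2) * expR (- qform B v / 2)) by rewrite mulrACA.
have -> : Num.sqrt (\det A / q) * Num.sqrt (\det B / q) =
    Num.sqrt (\det A * \det B / \det C) * Num.sqrt (\det C / q) *
    Num.sqrt (1 / q).
  rewrite -!sqrtrM ?mulr_ge0 ?invr_ge0 ?(ltW a0, ltW b0, ltW c0, ltW pi0)//.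
  by congr Num.sqrt; field; rewrite !gt_eqF.
have -> : expR (- qform A v / 2) * expR (- qform B v / 2) =
    expR (- qform C v / 2) * expR (- qform 1%:M v / 2).
  rewrite -!expRD; congr expR.
  have -> : qform C v = qform A v + qform B v - qform 1%:M v.
    by rewrite /qform /C mulmxBr mulmxDr mulmxBl mulmxDl !mxE.
  by field.
by ring.
Qed.

(** [g m m'] is the n-th power of the determinant ratio times the sample density of precision
    Omega_m + Omega_m' - 1; the latter has total mass 1, so the integral is the power alone. *)
Lemma gaussian_le_cam n p (I : finType) (Omega0 : posdefmx R p)
    (Omega : I -> posdefmx R p) (r : I -> I -> R) (K : R)
    (A : set (n.-tuple (p.-tuple mR))) :
  Omega0 = 1%:M :> 'M[R]_p ->
  (forall m m', posdef ((Omega m : 'M[R]_p) + Omega m' - 1%:M)) ->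
  (forall m m', Num.sqrt (\det (Omega m) * \det (Omega m') /
     \det ((Omega m : 'M[R]_p) + Omega m' - 1%:M)) ^+ n <= r m m') ->
  0 < K -> (0 < #|I|)%N ->
  \sum_(z : I * I) r z.1 z.2 <= K * #|I|%:R ^+ 2 ->
  measurable A ->
  ((4 * (K + 1))^-1%:E <= sample_prob n Omega0 A \/
   exists m, (4 * (K + 1))^-1%:E <= sample_prob n (Omega m) (~` A))%E.
Proof.
move=> Omega0E pd rE K0 I0 rK mA.
pose ratio m m' : R := Num.sqrt (\det (Omega m) * \det (Omega m') /
     \det ((Omega m : 'M[R]_p) + Omega m' - 1%:M)).
have mpd (B : 'M[R]_p) : measurable_fun setT
    (@power_density _ (p.-tuple mR) R (gaussian_pdf B) n).
  by apply: measurable_power_density; exact (measurable_gaussian_pdf _).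
have pd0 (B : 'M[R]_p) x :
    0 <= @power_density _ (p.-tuple mR) R (gaussian_pdf B) n x.
  by apply: power_density_ge0 => y; exact: gaussian_pdf_ge0.
apply: (@le_cam _ _ _ _ (power_measure (@lebesgue_measure_tuple R p) n)
  (sample_prob n Omega0) (fun m => sample_prob n (Omega m))
  (power_density (gaussian_pdf 1%:M))
  (fun m => power_density (gaussian_pdf (Omega m)))
  (fun m m' x => ratio m m' ^+ n *
    power_density (gaussian_pdf ((Omega m : 'M[R]_p) + Omega m' - 1%:M)) x)
  r K) => //.
- by move=> m m'; exact: measurable_funM.
- by move=> m m' x; rewrite mulr_ge0// exprn_ge0// sqrtr_ge0.
- by move=> B mB; rewrite -Omega0E; exact: sample_prob_density.
- by move=> m B mB; exact: sample_prob_density.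
- move=> m m' x; rewrite /power_density -!big_split/=.
  rewrite -[X in _ ^+ X]card_ord -prodr_const -!big_split/=.
  apply: eq_bigr => i _; apply: gaussian_pdf_mul => //; exact: posdefmxP.
move=> m m'.
under eq_integral do rewrite EFinM.
rewrite ge0_integralZl_EFin//; last 3 first.
- by move=> x _; rewrite lee_fin.
- exact/measurable_EFinP.
- by rewrite exprn_ge0// sqrtr_ge0.
rewrite -(@sample_prob_density _ _ (PosDefMx (pd m m')) setT)//.
by rewrite probability_setT mule1 lee_fin rE.
Qed.

End gaussian_le_cam.

(** * Quadratic forms and the class G0 *)

Section precision.
Variables (R : realType) (p : nat).
Implicit Types (u v w x y : 'rV[R]_p) (U V : {set 'I_p}).

Definition dot x y : R := (x *m y^T) 0 0.

Lemma dotE x y : dot x y = \sum_i x 0 i * y 0 i.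
Proof. by rewrite /dot mxE; apply: eq_bigr => i _; rewrite mxE. Qed.

Lemma dotC x y : dot x y = dot y x.
Proof. by rewrite !dotE; apply: eq_bigr => i _; rewrite mulrC. Qed.

Lemma dotDr x y w : dot x (y + w) = dot x y + dot x w.
Proof. by rewrite /dot linearD/= mulmxDr mxE. Qed.

Lemma dotDl x y w : dot (y + w) x = dot y x + dot w x.
Proof. by rewrite !(dotC _ x) dotDr. Qed.

Lemma dotZl a x y : dot (a *: x) y = a * dot x y.
Proof. by rewrite /dot -scalemxAl mxE. Qed.

Lemma dotZr a x y : dot x (a *: y) = a * dot x y.
Proof. by rewrite dotC dotZl dotC. Qed.

Lemma dot_ge0 x : 0 <= dot x x.
Proof. by rewrite dotE sumr_ge0// => i _; rewrite -expr2 sqr_ge0. Qed.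

Lemma dot_gt0 x : x != 0 -> 0 < dot x x.
Proof.
move=> x0; rewrite lt_neqAle dot_ge0 andbT eq_sym; apply: contra x0.
rewrite dotE psumr_eq0 => [/allP xx|i _]; last by rewrite -expr2 sqr_ge0.
apply/eqP/rowP => i; rewrite mxE; apply/eqP.
by have := xx i (mem_index_enum _); rewrite mulf_eq0 orbb.
Qed.

Lemma dot_tensl u v x : dot (x *m (u^T *m v)) x = dot x u * dot x v.
Proof.
rewrite /dot !mulmxA -[x *m u^T *m v *m _]mulmxA mxE big_ord1.
by rewrite -!/(dot _ _) (dotC v).
Qed.

Lemma dot_CauchySchwarz x y : dot x y ^+ 2 <= dot x x * dot y y.
Proof.
have [->|y0] := eqVneq y 0.
  by rewrite /dot trmx0 !mulmx0 mxE expr0n/= mulr0.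
have dy := dot_gt0 y0; rewrite -(ler_pM2l dy) -subr_ge0.
have := dot_ge0 (dot y y *: x - dot x y *: y).
rewrite -scaleNr dotDl !dotDr !dotZl !dotZr (dotC y x).
by congr (0 <= _); ring.
Qed.

Lemma qform_dot (A : 'M[R]_p) x : qform A x = dot (x *m A) x.
Proof. by []. Qed.

Lemma qform1 x : qform 1%:M x = dot x x.
Proof. by rewrite /qform mulmx1. Qed.

Lemma qformD (A B : 'M[R]_p) x : qform (A + B) x = qform A x + qform B x.
Proof. by rewrite /qform mulmxDr mulmxDl mxE. Qed.

Lemma qformZ a (A : 'M[R]_p) x : qform (a *: A) x = a * qform A x.
Proof. by rewrite /qform -scalemxAr -scalemxAl mxE. Qed.

Lemma qform_addB1 (A B : 'M[R]_p) x :
  qform (A + B - 1%:M) x = qform A x + qform B x - dot x x.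
Proof. by rewrite -scaleN1r !qformD qformZ qform1 mulN1r. Qed.

Lemma qform_tens u v x : qform (u^T *m v) x = dot x u * dot x v.
Proof. exact: dot_tensl. Qed.

(** The matrix determinant lemma: the determinant of one bordered matrix is computed by the Schur
    complement of its corner and again by a product of block triangular matrices. *)
Lemma det_1Dtens u v : \det (1%:M + u^T *m v) = 1 + dot v u.
Proof.
pose A : 'M[R]_(1 + p) := block_mx 1%:M (- v) u^T 1%:M.
have A00 : A 0 0 = 1.
  have -> : A 0 0 = A (lshift p 0) (lshift p 0).
    by congr (A _ _); exact/val_inj.
  by rewrite block_mxEul mxE eqxx.
have detA : \det A = \det (1%:M + u^T *m v).
  rewrite det_schur A00 ?oner_eq0// mul1r /schur A00 invr1 scale1r.
  by rewrite block_mxKdr block_mxKdl block_mxKur mulmxN opprK.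
rewrite -detA.
have -> : A = block_mx (1%:M + v *m u^T) (- v) 0 1%:M *m
    block_mx 1%:M 0 u^T 1%:M.
  rewrite mulmx_block !mulmx1 !mul0mx !mulmx0 !mul1mx !add0r.
  by rewrite mulNmx addrK.
rewrite det_mulmx det_ublock det_lblock !det1 !mulr1.
by rewrite det_mx11 mxE [X in X + _]mxE eqxx.
Qed.

Definition ind U : 'rV[R]_p := \row_i (i \in U)%:R.

Lemma dot_ind U V : dot (ind U) (ind V) = #|U :&: V|%:R.
Proof.
rewrite dotE -sum1_card natr_sum [RHS]big_mkcond/=; apply: eq_bigr => i _.
by rewrite !mxE finset.in_setI -natrM mulnb; case: (_ && _).
Qed.

Lemma posdef_of_qform (A : 'M[R]_p) (c : R) : 0 < c -> A^T = A ->
  (forall x, c * dot x x <= qform A x) -> posdef A.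
Proof.
move=> c0 symA Ac; split=> // x x0; apply: lt_le_trans (Ac x).
by rewrite mulr_gt0// dot_gt0.
Qed.

(* The hypothesis on the eigenvector only serves to make the spectrum
   nonempty, since inf and sup of the empty set are 0. *)
Lemma G0_of_qform (M : R) k (Omega : posdefmx R p) x :
  0 < M -> x != 0 -> x *m Omega = x ->
  (forall y, M^-1 * dot y y <= qform Omega y <= M * dot y y) ->
  (forall j, (\sum_(i < p) (Omega i j != 0%R) <= k)%N) ->
  G0 p M k Omega.
Proof.
move=> M0 x0 xO qO supp.
have ev a : eigenvalue Omega a -> M^-1 <= a <= M.
  move=> /eigenvalueP[y yO y0]; have := qO y.
  by rewrite qform_dot yO dotZl !ler_pM2r ?dot_gt0.
have ev1 : eigenvalue Omega 1.
  by apply/eigenvalueP; exists x => //; rewrite scale1r.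
have hinf : has_inf [set a | eigenvalue Omega a].
  by split; [exists 1|exists M^-1 => a /ev /andP[]].
have hsup : has_sup [set a | eigenvalue Omega a].
  by split; [exists 1|exists M => a /ev /andP[]].
split.
- by apply/bigmax_leqP => j _; exact: supp.
- by apply: lb_le_inf; [exists 1|move=> a /ev /andP[]].
- apply: (@le_trans _ _ 1); first exact: (ge_inf hinf.2).
  exact: (ub_le_sup hsup.2).
- by apply: ge_sup; [exists 1|move=> a /ev /andP[]].
Qed.

Lemma sum_supp_le (A : 'M[R]_p) j k U : (#|U| <= k)%N ->
  (forall i, i \notin U -> A i j = 0) -> (\sum_(i < p) (A i j != 0%R) <= k)%N.
Proof.
move=> Uk A0; apply: leq_trans Uk; rewrite -sum1_card [leqRHS]big_mkcond/=.
by apply: leq_sum => i _; case: ifPn => [|/A0 ->]; rewrite ?leq_b1 ?eqxx.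
Qed.

End precision.

(** * Least favourable families *)

Section families.
Variables (R : realType) (p : nat).
Implicit Types (u v w x y : 'rV[R]_p) (a : R).

Definition tens u v : 'M[R]_p := u^T *m v.

Lemma tensE u v i j : tens u v i j = u 0 i * v 0 j.
Proof. by rewrite /tens mxE big_ord1 mxE. Qed.

Lemma tr_tens u v : (tens u v)^T = tens v u.
Proof. by rewrite /tens trmx_mul trmxK. Qed.

Lemma tensDr u v w : tens u (v + w) = tens u v + tens u w.
Proof. exact: mulmxDr. Qed.

Lemma tensDl u v w : tens (v + w) u = tens v u + tens w u.
Proof. by rewrite /tens linearD mulmxDl. Qed.

Lemma mul_tens u v x y : tens u v *m tens x y = dot v x *: tens u y.
Proof.
rewrite /tens mulmxA -[_ *m v *m _]mulmxA [v *m _]mx11_scalar.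
by rewrite mul_mx_scalar -scalemxAl.
Qed.

Lemma det_1Dscale_tens a u v : \det (1%:M + a *: tens u v) = 1 + a * dot u v.
Proof.
by rewrite /tens scalemxAr det_1Dtens dotZl dotC.
Qed.

Definition spike a u : 'M[R]_p := 1%:M + a *: tens u u.

Lemma tr_spike a u : (spike a u)^T = spike a u.
Proof. by rewrite /spike linearD linearZ/= trmx1 tr_tens. Qed.

Lemma spikeE a u i j : spike a u i j = (i == j)%:R + a * (u 0 i * u 0 j).
Proof. by rewrite -tensE !mxE. Qed.

Lemma qform_spike a u x : qform (spike a u) x = dot x x + a * dot x u ^+ 2.
Proof. by rewrite /spike qformD qformZ qform1 qform_tens. Qed.

(** Pairing a spike with itself thus gives the ratio (1 + b)^2 / (1 + 2 b) under the root, where b =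
    a |u|^2. *)
Lemma spike_double a u : spike a u + spike a u - 1%:M = spike (2 * a) u.
Proof. by apply/matrixP => i j; rewrite !mxE; ring. Qed.

(** For orthogonal directions the determinant ratio is therefore exactly 1: distinct alternatives do
    not interact. *)
Lemma spike_orthogonal a u v : dot u v = 0 ->
  spike a u + spike a v - 1%:M = spike a u *m spike a v.
Proof.
move=> uv; rewrite /spike mulmxDl !mulmxDr !mul1mx mulmx1 -scalemxAl -scalemxAr.
rewrite mul_tens uv scale0r !scaler0 addr0.
by apply/matrixP => i j; rewrite !mxE; ring.
Qed.

(** The product (1 + a u^T v)(1 + a v^T u) multiplied out, see [linkedN]; this form shows the
    entries and the quadratic form, the product gives the determinant. *)
Definition linked a u v : 'M[R]_p :=
  1%:M + a *: (tens u v + tens v u) + (a ^+ 2 * dot v v) *: tens u u.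

Lemma linkedE a u v i j : linked a u v i j = (i == j)%:R +
  a * (u 0 i * v 0 j + v 0 i * u 0 j) + a ^+ 2 * dot v v * (u 0 i * u 0 j).
Proof. by rewrite -!tensE !mxE mulrDr. Qed.

Lemma tr_linked a u v : (linked a u v)^T = linked a u v.
Proof.
by apply/matrixP => i j; rewrite mxE !linkedE eq_sym; ring.
Qed.

Lemma qform_linked a u v x : qform (linked a u v) x =
  dot x x + 2 * a * (dot x u * dot x v) + a ^+ 2 * dot v v * dot x u ^+ 2.
Proof.
rewrite /linked !qformD !qformZ qformD qform1 !qform_tens.
by ring.
Qed.

Lemma linkedN a u v : linked a u v =
  (1%:M + a *: tens u v) *m (1%:M + a *: tens v u).
Proof.
rewrite mulmxDl !mulmxDr !mul1mx mulmx1 -scalemxAl -scalemxAr mul_tens.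
by apply/matrixP => i j; rewrite !mxE -!/(tens _ _); ring.
Qed.

Lemma det_linked a u v : dot u v = 0 -> \det (linked a u v) = 1.
Proof.
move=> uv; rewrite linkedN det_mulmx !det_1Dscale_tens (dotC v) uv.
by rewrite mulr0 addr0 mulr1.
Qed.

(** Completing the square with v + w produces a^2 |v + w|^2 u^T u, which exceeds the required term
    by 2 a^2 (v . w) u^T u. A middle factor removes the excess, and the outer factors have
    determinant 1 because u is orthogonal to v + w. *)
Lemma det_linked_pair a u v w : dot u v = 0 -> dot u w = 0 ->
  dot v v = dot w w ->
  \det (linked a u v + linked a u w - 1%:M) =
  1 - 2 * a ^+ 2 * dot v w * dot u u.
Proof.
move=> uv uw vw.
have uvw : dot u (v + w) = 0 by rewrite dotDr uv uw addr0.
have -> : linked a u v + linked a u w - 1%:M =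
    (1%:M + a *: tens u (v + w)) *m
    (1%:M + (- (2 * a ^+ 2 * dot v w)) *: tens u u) *m
    (1%:M + a *: tens (v + w) u).
  rewrite [X in X *m _]mulmxDl !mulmxDr !mulmx1 !mul1mx -scalemxAl -scalemxAr.
  rewrite mul_tens (dotC _ u) uvw scale0r !scaler0 addr0.
  rewrite !mulmxDl !mul1mx -!scalemxAl -!scalemxAr !mul_tens.
  rewrite uvw scale0r !scaler0 addr0 dotDl !dotDr (dotC w v).
  rewrite tensDl tensDr; apply/matrixP => i j; rewrite !mxE vw.
  by ring.
rewrite !det_mulmx !det_1Dscale_tens [dot (v + w) u]dotC uvw.
by ring.
Qed.

End families.

(** Generating function of the number of agreements of two functions. For a fixed first function the
    sum over the second factors over coordinates; each coordinate gives [z] for the one agreeing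
    value and 1 for the others. *)
Lemma sum_expr_agree (R : comPzRingType) (I J : finType) (z : R) :
  \sum_(h : {ffun I -> J} * {ffun I -> J})
    z ^+ #|[pred t | h.1 t == h.2 t]| =
  (#|J|%:R * (#|J|%:R - 1 + z)) ^+ #|I|.
Proof.
rewrite -(pair_bigA _ (fun f f' : {ffun I -> J} =>
  z ^+ #|[pred t | f t == f' t]|))/=.
rewrite exprMn.
under eq_bigr => f _.
  have -> : \sum_(f' : {ffun I -> J}) z ^+ #|[pred t | f t == f' t]| =
      (#|J|%:R - 1 + z) ^+ #|I|.
    transitivity (\sum_(f' : {ffun I -> J})
        \prod_(t : I) (if f t == f' t then z else 1)).
      apply: eq_bigr => f' _; rewrite -big_mkcond/= prodr_const.
      by congr (_ ^+ _); exact: eq_card.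
    transitivity (\prod_(t : I) \sum_b (if f t == b then z else 1)).
      by rewrite bigA_distr_bigA.
    under eq_bigr => t _.
      rewrite (bigD1 (f t))//= eqxx (eq_bigr (fun=> 1)); last first.
        by move=> b /negbTE; rewrite eq_sym => ->.
      rewrite sumr_const cardC1 addrC.
      have -> : #|J|.-1%:R = #|J|%:R - 1 :> R.
        by rewrite -subn1 natrB//; apply/card_gt0P; exists (f t).
      over.
    by rewrite prodr_const.
  over.
by rewrite sumr_const card_ffun -[LHS]mulr_natl natrX.
Qed.

(** * Scalar estimates of the determinant ratios and measurability of the maximum norm *)

Section bounds.
Variable R : realType.

Lemma sqrt_le_of_sqr (x y : R) : 0 <= y -> x <= y ^+ 2 -> Num.sqrt x <= y.
Proof.
by move=> y0 xy; rewrite -[leRHS](ger0_norm y0) -sqrtr_sqr ler_wsqrtr.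
Qed.

(** The ratio equals 1 + b^2 / (1 + 2 b), at most 1 + b^2, hence at most the square of
    [expR (b ^+ 2)]. *)
Lemma sqrt_spike_ratio_le (b : R) : 0 <= b ->
  Num.sqrt ((1 + b) * (1 + b) / (1 + 2 * b)) <= expR (b ^+ 2).
Proof.
move=> b0; apply: sqrt_le_of_sqr; first exact: expR_ge0.
have b2 : 0 < 1 + 2 * b by nra.
rewrite ler_pdivrMr//.
have h : 1 + b ^+ 2 <= expR (b ^+ 2) ^+ 2.
  have := expR_ge1Dx (b ^+ 2); have := sqr_ge0 b.
  move: (b ^+ 2) (expR _) => c E; nra.
apply: le_trans (ler_wpM2r (ltW b2) h); nra.
Qed.

(** On this range 1 / (1 - x) is at most 1 + 2 x, hence at most the square of [expR x]. The factors
    [1 * 1] are the determinants of the two linked matrices. *)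
Lemma sqrt_linked_ratio_le (x : R) : 0 <= x -> x <= 2^-1 ->
  Num.sqrt (1 * 1 / (1 - x)) <= expR x.
Proof.
move=> x0 x2; apply: sqrt_le_of_sqr; first exact: expR_ge0.
rewrite ler_pdivrMr; last by lra.
have h : 1 + 2 * x <= expR x ^+ 2 by have := expR_ge1Dx x; nra.
have x1 : 0 <= 1 - x by lra.
apply: le_trans (ler_wpM2r x1 h); nra.
Qed.

End bounds.

Section measurable_norm.
Context d (T : measurableType d) (R : realType) (m n : nat).

(** The norm of a matrix is the maximum absolute entry, so this is a finite maximum of measurable
    functions. *)
Lemma measurable_mx_norm_sub (f : T -> 'M[R]_(m, n)) (A : 'M[R]_(m, n)) :
  (forall i j, measurable_fun setT (fun x => f x i j)) ->
  measurable_fun setT (fun x => `|f x - A|).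
Proof.
move=> mf; rewrite (_ : (fun x => _) = fun x =>
    \big[Num.max/0]_(ij : 'I_m * 'I_n) `|f x ij.1 ij.2 - A ij.1 ij.2|);
  last first.
  apply/funext => x; rewrite [LHS]mx_normrE.
  by apply: eq_bigr => ij _; rewrite !mxE.
elim: (index_enum _) => [|ij s IHs].
  by under eq_fun do rewrite big_nil; exact: measurable_cst.
under eq_fun do rewrite big_cons.
apply: measurable_maxr => //; apply: measurableT_comp => //.
by apply: measurable_funB.
Qed.

End measurable_norm.

Lemma ler_mx_norm (R : realType) m n (A : 'M[R]_(m, n)) i j : `|A i j| <= `|A|.
Proof.
rewrite [leRHS]mx_normrE.
exact: (le_bigmax _ (fun ij : 'I_m * 'I_n => `|A ij.1 ij.2|) (i, j)).
Qed.

(** * Spectral bounds and membership of the families in the class *)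

Section membership.
Variables (R : realType) (p : nat).
Implicit Types (u v x : 'rV[R]_p) (a : R) (U V : {set 'I_p}).

Lemma qform_spike_ge a u x : 0 <= a -> 1 * dot x x <= qform (spike a u) x.
Proof. by move=> a0; rewrite qform_spike mul1r lerDl mulr_ge0// sqr_ge0. Qed.

Lemma qform_spike_le a u x : 0 <= a ->
  qform (spike a u) x <= (1 + a * dot u u) * dot x x.
Proof.
move=> a0; rewrite qform_spike mulrDl mul1r lerD2l -mulrA ler_wpM2l//.
by rewrite [leRHS]mulrC dot_CauchySchwarz.
Qed.

(** By Cauchy-Schwarz, half the cross term has absolute value at most e |x|^2, and the square term
    lies between 0 and e^2 |x|^2, at most e |x|^2. *)
Lemma qform_linked_bounds a u v x (e : R) : 0 <= a -> 0 <= e -> e <= 1 ->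
  a ^+ 2 * (dot u u * dot v v) <= e ^+ 2 ->
  (1 - 2 * e) * dot x x <= qform (linked a u v) x <= (1 + 3 * e) * dot x x.
Proof.
move=> a0 e0 e1 ae; rewrite qform_linked.
have X0 := dot_ge0 x; have q0 := dot_ge0 u; have s0 := dot_ge0 v.
have uX := dot_CauchySchwarz x u; have vX := dot_CauchySchwarz x v.
set X := dot x x in X0 uX vX *; set q := dot u u in q0 ae uX.
set s := dot v v in s0 ae vX *; set xu := dot x u in uX *.
set xv := dot x v in vX *.
have cross : `|a * (xu * xv)| <= e * X.
  rewrite -ler_sqr ?nnegrE ?mulr_ge0// -normrX ger0_norm ?sqr_ge0//.
  apply: (@le_trans _ _ (a ^+ 2 * ((X * q) * (X * s)))).
    by rewrite !exprMn ler_wpM2l ?sqr_ge0// ler_pM ?sqr_ge0.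
  have -> : a ^+ 2 * (X * q * (X * s)) = a ^+ 2 * (q * s) * X ^+ 2 by ring.
  by rewrite exprMn ler_wpM2r// sqr_ge0.
have quad : a ^+ 2 * s * xu ^+ 2 <= e * X.
  apply: (@le_trans _ _ (a ^+ 2 * s * (X * q))).
    by rewrite ler_wpM2l// mulr_ge0// sqr_ge0.
  have -> : a ^+ 2 * s * (X * q) = a ^+ 2 * (q * s) * X by ring.
  rewrite ler_wpM2r//; apply: le_trans ae _; nra.
have quad0 : 0 <= a ^+ 2 * s * xu ^+ 2.
  by apply: mulr_ge0; rewrite ?sqr_ge0// mulr_ge0 ?sqr_ge0.
move: cross; rewrite ler_norml => /andP[c1 c2]; apply/andP; split; lra.
Qed.

Lemma posdef_spike a u : 0 <= a -> posdef (spike a u).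
Proof.
move=> a0; apply: (@posdef_of_qform _ _ _ 1) => //; first exact: tr_spike.
by move=> x; exact: qform_spike_ge.
Qed.

(** A coordinate left untouched by the perturbation supplies the fixed vector that [G0_of_qform]
    asks for. *)
Lemma delta_fixed (A : 'M[R]_p) l : (forall j, A l j = (l == j)%:R) ->
  (delta_mx 0 l : 'rV[R]_p) *m A = delta_mx 0 l.
Proof. by move=> Al; apply/rowP => j; rewrite -rowE !mxE eqxx/= Al eq_sym. Qed.

Lemma delta_neq0 l : (delta_mx 0 l : 'rV[R]_p) != 0.
Proof.
apply/eqP => /rowP/(_ l); rewrite !mxE !eqxx/= => /eqP.
by rewrite oner_eq0.
Qed.

Lemma exists_notin U : (#|U| < p)%N -> exists l, l \notin U.
Proof.
move=> Up; have /card_gt0P[l] : (0 < #|finset.setC U|)%N.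
  by rewrite cardsCs finset.setCK card_ord subn_gt0.
by rewrite finset.in_setC => lU; exists l.
Qed.

Lemma G0_spike (M : R) k a U (Omega : posdefmx R p) : 1 < M ->
  0 <= a -> a * #|U|%:R <= M - 1 ->
  (#|U| <= 2)%N -> (3 <= k)%N -> (k < p)%N ->
  Omega = spike a (ind R U) :> 'M[R]_p -> G0 p M k Omega.
Proof.
move=> M1 a0 aU U2 k3 kp OmegaE.
have M0 : 0 < M by lra.
have [|l lU] := @exists_notin U.
  by rewrite (leq_ltn_trans U2)// (leq_ltn_trans _ kp)// ltnW.
apply: (@G0_of_qform _ _ _ _ _ (delta_mx 0 l)) => //.
- exact: delta_neq0.
- rewrite OmegaE; apply: delta_fixed => j.
  by rewrite spikeE !mxE (negbTE lU) mul0r mulr0 addr0.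
- move=> y; rewrite OmegaE; apply/andP; split.
    apply: le_trans (qform_spike_ge _ _ a0); rewrite ler_wpM2r ?dot_ge0//.
    by rewrite invf_le1// ltW.
  apply: le_trans (qform_spike_le _ _ a0) _; rewrite ler_wpM2r ?dot_ge0//.
  by rewrite dot_ind finset.setIid; lra.
(* Column [j] lives on [j] and [U], at most 1 + 2 = 3 entries; this is where [3 <= k] enters. *)
- move=> j; apply: (@sum_supp_le _ _ _ _ _ (j |: U)%SET).
    rewrite (leq_trans _ k3)// cardsU1 (leq_add (leq_b1 _) U2)//.
  move=> i; rewrite finset.in_setU1 negb_or OmegaE spikeE !mxE => /andP[ij iU].
  by rewrite (negbTE ij) (negbTE iU) mul0r mulr0 addr0.
Qed.

End membership.

Section linked_membership.
Variables (R : realType) (p : nat).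
Implicit Types (a : R) (U V W : {set 'I_p}).

Lemma posdef1 : posdef (1%:M : 'M[R]_p).
Proof.
apply: (@posdef_of_qform _ _ _ 1) => [//||x]; first exact: trmx1.
by rewrite qform1 mul1r.
Qed.

Lemma G0_1 (M : R) k (Omega : posdefmx R p) :
  1 < M -> (3 <= k)%N -> (k < p)%N ->
  Omega = 1%:M :> 'M[R]_p -> G0 p M k Omega.
Proof.
move=> M1 k3 kp OmegaE; apply: (@G0_spike _ _ M k 0 finset.set0) => //.
- by rewrite mul0r; lra.
- by rewrite cards0.
- by rewrite OmegaE /spike scale0r addr0.
Qed.

Lemma linked_bounds (M a : R) U V x : 1 < M -> 0 <= a ->
  a ^+ 2 * (#|U| * #|V|)%:R <= ((1 - M^-1) / 5) ^+ 2 ->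
  [/\ M^-1 * dot x x <= qform (linked a (ind R U) (ind R V)) x,
      3 / 5 * dot x x <= qform (linked a (ind R U) (ind R V)) x &
      qform (linked a (ind R U) (ind R V)) x <= M * dot x x].
Proof.
move=> M1 a0 aUV.
have M0 : 0 < M by lra.
have m0 : 0 < M^-1 by rewrite invr_gt0.
have mM : M^-1 * M = 1 by rewrite mulVf// gt_eqF.
have m1 : M^-1 < 1 by rewrite invf_lt1.
(* With this [e], 1 - 2 e is at least both 1 / M and 3 / 5, and 1 + 3 e is at most M. *)
set e := (1 - M^-1) / 5 in aUV.
have e0 : 0 <= e by rewrite /e; lra.
have e1 : e <= 1 by rewrite /e; lra.
have /andP[] : (1 - 2 * e) * dot x x <= qform (linked a (ind R U) (ind R V)) x
    <= (1 + 3 * e) * dot x x.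
  by apply: qform_linked_bounds => //; rewrite !dot_ind !finset.setIid -natrM.
have X0 := dot_ge0 x; rewrite /e.
move: (qform _ _) (dot x x) X0 => Q X X0 lo hi.
split.
- by apply: le_trans lo; rewrite ler_wpM2r//; lra.
- by apply: le_trans lo; rewrite ler_wpM2r//; lra.
- by apply: le_trans hi _; rewrite ler_wpM2r//; nra.
Qed.

Lemma posdef_linked (M a : R) U V : 1 < M -> 0 <= a ->
  a ^+ 2 * (#|U| * #|V|)%:R <= ((1 - M^-1) / 5) ^+ 2 ->
  posdef (linked a (ind R U) (ind R V)).
Proof.
move=> M1 a0 aUV; apply: (@posdef_of_qform _ _ _ (3 / 5)) => [||x]; first lra.
  exact: tr_linked.
by have [] := linked_bounds x M1 a0 aUV.
Qed.

(** Each form is at least 3 / 5 of |x|^2, so the combination is at least 3/5 + 3/5 - 1 = 1/5 of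
    it. *)
Lemma posdef_linked_pair (M a : R) U V W : 1 < M -> 0 <= a ->
  a ^+ 2 * (#|U| * #|V|)%:R <= ((1 - M^-1) / 5) ^+ 2 ->
  a ^+ 2 * (#|U| * #|W|)%:R <= ((1 - M^-1) / 5) ^+ 2 ->
  posdef (linked a (ind R U) (ind R V) + linked a (ind R U) (ind R W) - 1%:M).
Proof.
move=> M1 a0 aUV aUW; apply: (@posdef_of_qform _ _ _ 5^-1) => [||x].
- by rewrite invr_gt0.
- pose L V' := linked a (ind R U) (ind R V').
  have E i j : (L V + L W - 1%:M) i j = L V i j + L W i j - (i == j)%:R.
    by rewrite !mxE.
  have symL V' i j : L V' j i = L V' i j by rewrite /L -[in LHS]tr_linked mxE.
  by apply/matrixP => i j; rewrite mxE !E !(symL _ i j) eq_sym.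
have [_ lV _] := linked_bounds x M1 a0 aUV.
have [_ lW _] := linked_bounds x M1 a0 aUW.
have X0 := dot_ge0 x.
rewrite qform_addB1; lra.
Qed.

Lemma G0_linked (M : R) k a U V (Omega : posdefmx R p) : 1 < M -> 0 <= a ->
  a ^+ 2 * (#|U| * #|V|)%:R <= ((1 - M^-1) / 5) ^+ 2 ->
  (#|U| <= 2)%N -> (3 <= k)%N -> (#|U| + #|V| <= k)%N -> (k < p)%N ->
  Omega = linked a (ind R U) (ind R V) :> 'M[R]_p -> G0 p M k Omega.
Proof.
move=> M1 a0 aUV U2 k3 UVk kp OmegaE.
have M0 : 0 < M by lra.
have cUV : (#|U :|: V|%SET <= k)%N.
  by rewrite (leq_trans _ UVk)// cardsU leq_subr.
have [|l] := @exists_notin p (U :|: V)%SET; first exact: leq_ltn_trans kp.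
rewrite finset.in_setU negb_or => /andP[lU lV].
apply: (@G0_of_qform _ _ _ _ _ (delta_mx 0 l)) => //.
- exact: delta_neq0.
- rewrite OmegaE; apply: delta_fixed => j.
  by rewrite linkedE !mxE (negbTE lU) (negbTE lV) /=; ring.
- move=> y; rewrite OmegaE; have [? _ ?] := linked_bounds y M1 a0 aUV.
  exact/andP.
(* Only columns in [U] meet all of [V], with at most |U| + |V| entries; any other column lives on
   [j] and [U], at most 3 entries. *)
- move=> j; have [jU|jU] := boolP (j \in U).
    apply: (@sum_supp_le _ _ _ _ _ (U :|: V)%SET) => // i.
    rewrite finset.in_setU negb_or => /andP[iU iV].
    have ij : i != j by apply: contraNneq iU => ->.
    by rewrite OmegaE linkedE !mxE (negbTE ij) (negbTE iU) (negbTE iV) /=; ring.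
  apply: (@sum_supp_le _ _ _ _ _ (j |: U)%SET).
    by rewrite (leq_trans _ k3)// cardsU1 (leq_add (leq_b1 _) U2).
  move=> i; rewrite finset.in_setU1 negb_or OmegaE linkedE !mxE => /andP[ij iU].
  by rewrite (negbTE ij) (negbTE iU) (negbTE jU) /=; ring.
Qed.

End linked_membership.

Lemma exists_injective_notin p (T : finType) (U : {set 'I_p}) :
  (#|T| + #|U| <= p)%N ->
  exists2 pos : T -> 'I_p, injective pos & forall t, pos t \notin U.
Proof.
move=> TU; have le : (#|T| <= #|finset.setC U|)%N.
  by rewrite -(leq_add2r #|U|) (leq_trans TU)// addnC cardsC card_ord.
exists (fun t => enum_val (widen_ord le (enum_rank t))).
  move=> t t' /enum_val_inj/(congr1 val)/= tt'; apply: enum_rank_inj.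
  exact: val_inj.
by move=> t; rewrite -finset.in_setC enum_valP.
Qed.

Lemma measurable_superlevel d (T : measurableType d) (R : realType) (f : T -> R)
    (c : R) : measurable_fun setT f -> measurable [set x | (c < f x)%R].
Proof.
move=> mf; rewrite (_ : [set x | _] = setT `&` f @^-1` `]c, +oo[).
  by apply: mf => //; exact: measurable_itv.
by rewrite setTI; apply/seteqP; split=> x; rewrite /= in_itv/= andbT.
Qed.

(** * Minimax lower bounds *)

Section minimax.
Variable R : realType.
Local Notation mR := (measurableTypeR R).

(** Reduction of estimation to testing: the test rejects [Omega0] when its loss exceeds [delta].
    Where it accepts, the separation hypothesis forces the loss at every [Omega m] above [delta]. *)
Lemma le_cam_G0 n p (M : R) k (I : finType) (Omega0 : posdefmx R p)
    (Omega : I -> posdefmx R p) (r : I -> I -> R) (K delta : R)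
    (loss : n.-tuple (p.-tuple mR) -> posdefmx R p -> R) :
  (forall Theta, measurable_fun setT (loss ^~ Theta)) ->
  (forall x m, 2 * delta < loss x Omega0 + loss x (Omega m)) ->
  G0 p M k Omega0 -> (forall m, G0 p M k (Omega m)) ->
  Omega0 = 1%:M :> 'M[R]_p ->
  (forall m m', posdef ((Omega m : 'M[R]_p) + Omega m' - 1%:M)) ->
  (forall m m', Num.sqrt (\det (Omega m) * \det (Omega m') /
     \det ((Omega m : 'M[R]_p) + Omega m' - 1%:M)) ^+ n <= r m m') ->
  0 < K -> (0 < #|I|)%N ->
  \sum_(z : I * I) r z.1 z.2 <= K * #|I|%:R ^+ 2 ->
  exists2 Theta, G0 p M k Theta &
    ((4 * (K + 1))^-1%:E <=
     sample_prob n Theta [set x | (delta < loss x Theta)%R])%E.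
Proof.
move=> mloss sep G00 G0m Omega0E pd rE K0 I0 rK.
pose B Theta := [set x | (delta < loss x Theta)%R].
have mB Theta : measurable (B Theta) by exact: measurable_superlevel.
have [h|[m h]] := gaussian_le_cam Omega0E pd rE K0 I0 rK (mB Omega0).
  by exists Omega0.
exists (Omega m) => //; apply: le_trans h _; apply: le_measure.
- by rewrite inE; exact: measurableC.
- by rewrite inE; exact: mB.
- by move=> x /negP; rewrite -leNgt /B/= => h; have := sep x m; lra.
Qed.

Lemma dist_sep (V : normedZmodType R) (e a b : V) (delta : R) :
  2 * delta < `|b - a| ->
  2 * delta < `|e - a| + `|e - b|.
Proof.
move=> ab; apply: lt_le_trans ab _.
by rewrite (distrC e b) [leRHS]addrC; exact: ler_distD.
Qed.

Lemma measurable_entry_loss n p (est : n.-tuple (p.-tuple mR) -> R) (c : R) :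
  measurable_fun setT est -> measurable_fun setT (fun x => `|est x - c|).
Proof.
by move=> mest; apply: measurableT_comp => //; exact: measurable_funB.
Qed.

Lemma card_pair_le2 p (i j : 'I_p) : (#|[set i; j]%SET| <= 2)%N.
Proof. by rewrite cards2; case: eqP. Qed.

(* Least favourable family for the k log p / n rate: S_f picks one index in
   each of the s blocks of size B, so that overlaps |S_f :&: S_f'| are
   Binomial(s, 1/B) under the uniform prior. *)
Lemma minimax_entry_overlap n p k (M a delta : R) (i j : 'I_p) s B
    (est : n.-tuple (p.-tuple mR) -> R) : measurable_fun setT est ->
  1 < M -> (3 <= k)%N -> (k < p)%N -> (s + 2 <= k)%N -> (0 < B)%N ->
  (s * B + 2 <= p)%N -> 0 <= a ->
  2 * a ^+ 2 * s%:R <= ((1 - M^-1) / 5) ^+ 2 ->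
  s%:R * expR (n%:R * (4 * a ^+ 2)) <= 4 * B%:R ->
  2 * delta < a ^+ 2 * s%:R ->
  exists2 Theta, G0 p M k Theta &
    ((4 * (expR 4 + 1))^-1%:E <=
     sample_prob n Theta [set x | (delta < `|est x - Theta i j|)%R])%E.
Proof.
move=> mest M1 k3 kp sk B0 sB a0 ae sz sep.
pose U := [set i; j]%SET; have U2 : (#|U| <= 2)%N by exact: card_pair_le2.
have [|pos posI posU] := @exists_injective_notin p ('I_s * 'I_B)%type U.
  by rewrite card_prod !card_ord (leq_trans _ sB)// leq_add2l.
pose J := {ffun 'I_s -> 'I_B}.
pose S (f : J) := [set pos (t, f t) | t in 'I_s]%SET.
have posf_inj (f : J) : injective (fun t => pos (t, f t)).
  by move=> t t' /posI[].
have cS f : #|S f| = s by rewrite card_imset// card_ord.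
have US f : (U :&: S f = finset.set0)%SET.
  apply/finset.setP => l; rewrite finset.in_setI finset.in_set0.
  apply/negbTE/negP => /andP[lU /imsetP[t _ lE]].
  by have := posU (t, f t); rewrite -lE lU.
have SS f f' : #|S f :&: S f'|%SET = #|[pred t | f t == f' t]|.
  rewrite -(card_imset (mem [pred t | f t == f' t]) (posf_inj f)).
  apply: eq_card => l; rewrite finset.in_setI.
  apply/andP/imsetP => [[/imsetP[t _ ->] /imsetP[t' _ /posI[<- ff']]]|[t]].
    by exists t => //; rewrite inE ff'.
  rewrite inE => /eqP ff' ->; split; apply/imsetP; exists t => //.
  by rewrite ff'.
have aUS f : a ^+ 2 * (#|U| * #|S f|)%:R <= ((1 - M^-1) / 5) ^+ 2.
  apply: le_trans ae; rewrite cS natrM.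
  rewrite [leRHS](_ : _ = a ^+ 2 * (2 * s%:R)); last by ring.
  by rewrite ler_wpM2l ?sqr_ge0// ler_wpM2r// ler_nat.
pose Om f := PosDefMx (posdef_linked M1 a0 (aUS f)).
pose Om0 := PosDefMx (posdef1 R p).
have uv f : dot (ind R U) (ind R (S f)) = 0 by rewrite dot_ind US cards0.
have vv f : dot (ind R (S f)) (ind R (S f)) = s%:R.
  by rewrite dot_ind finset.setIid cS.
have entry f : Om f i j = (i == j)%:R + a ^+ 2 * s%:R.
  have inS l : l \in U -> l \in S f = false.
    by move=> lU; have /finset.setP/(_ l) := US f;
      rewrite finset.in_setI finset.in_set0 lU.
  have iU : i \in U by rewrite !finset.inE eqxx.
  have jU : j \in U by rewrite !finset.inE eqxx orbT.
  by rewrite /= linkedE vv !mxE iU jU !inS//=; ring.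
(* Bound on the factor that each shared index contributes to the integral over the sample; |U| is 2,
   or 1 when [i = j]. *)
pose z := expR (n%:R * (2 * a ^+ 2 * #|U|%:R)) : R.
have z_le : z <= expR (n%:R * (4 * a ^+ 2)).
  rewrite ler_expR ler_wpM2l//.
  have : #|U|%:R <= 2 :> R by rewrite ler_nat.
  have := sqr_ge0 a; nra.
apply: (@le_cam_G0 n p M k J Om0 Om
  (fun f f' => z ^+ #|[pred t | f t == f' t]|) (expR 4) delta
  (fun x Theta => `|est x - Theta i j|)) => //.
- by move=> Theta; exact: measurable_entry_loss.
- move=> x f; apply: dist_sep; rewrite entry /Om0/= mxE addrAC subrr add0r.
  by rewrite ger0_norm// mulr_ge0// sqr_ge0.
- exact: G0_1.
- move=> f; apply: (@G0_linked _ _ M k a U (S f)) => //.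
  by rewrite cS addnC (leq_trans _ sk)// leq_add2l.
- by move=> f f'; exact: (posdef_linked_pair M1).
- move=> f f'; rewrite /= !det_linked// det_linked_pair ?vv//.
  rewrite !dot_ind finset.setIid SS.
  set J' := #|[pred t | f t == f' t]|; set x := 2 * a ^+ 2 * J'%:R * #|U|%:R.
  have Js : (J' <= s)%N by rewrite (leq_trans (max_card _))// card_ord.
  have x0 : 0 <= x by rewrite !mulr_ge0// sqr_ge0.
  have x2 : x <= 2^-1.
    have m0 : 0 < M^-1 by rewrite invr_gt0; lra.
    (* Here [x] is 1 minus the determinant of the pair; this bound is below 2 / 25, well within the
       range of [sqrt_linked_ratio_le]. *)
    have : x <= 2 * ((1 - M^-1) / 5) ^+ 2.
      apply: (@le_trans _ _ (2 * (2 * a ^+ 2 * s%:R))); last first.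
        by rewrite ler_pM2l.
      rewrite /x [leRHS](_ : _ = 2 * a ^+ 2 * s%:R * 2); last by ring.
      rewrite ler_pM ?mulr_ge0 ?sqr_ge0 ?ler_nat//.
      by rewrite ler_wpM2l ?mulr_ge0 ?sqr_ge0 ?ler_nat.
    have m1 : M^-1 < 1 by rewrite invf_lt1//; lra.
    nra.
  apply: (@le_trans _ _ (expR x ^+ n)).
    by rewrite lerXn2r ?nnegrE ?sqrtr_ge0 ?expR_ge0// sqrt_linked_ratio_le.
  rewrite /z -!expRM_natl ler_expR le_eqVlt; apply/orP; left; apply/eqP.
  by rewrite /x; ring.
- by rewrite card_ffun !card_ord expn_gt0 B0.
rewrite sum_expr_agree !card_ffun !card_ord natrX -exprM mulnC exprM.
have b0 : 0 < B%:R :> R by rewrite ltr0n.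
(* Dividing out the number of pairs leaves (1 + (z - 1) / B)^s, at most exp(s z / B), and [sz]
   bounds s z / B by 4. *)
have -> : B%:R * (B%:R - 1 + z) = B%:R ^+ 2 * (1 + (z - 1) / B%:R).
  by field; rewrite gt_eqF.
rewrite exprMn mulrC ler_wpM2r ?exprn_ge0//.
have z1 : 1 <= z.
  by rewrite -expR0 ler_expR !mulr_ge0// sqr_ge0.
apply: (@le_trans _ _ (expR (z / B%:R) ^+ s)).
  rewrite lerXn2r ?nnegrE ?expR_ge0 ?addr_ge0 ?divr_ge0 ?subr_ge0 ?(ltW b0)//.
  apply: le_trans (expR_ge1Dx _); rewrite lerD2l ler_pM2r ?invr_gt0//; lra.
rewrite -expRM_natl ler_expR mulrA ler_pdivrMr//.
by apply: le_trans sz; rewrite ler_wpM2l.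
Qed.

(** A two-point test: the family has a single member, so the mixture is one Gaussian law and only
    the self-pairing ratio is needed. *)
Lemma minimax_entry_spike n p k (M a delta : R) (i j : 'I_p)
    (est : n.-tuple (p.-tuple mR) -> R) : measurable_fun setT est ->
  1 < M -> (3 <= k)%N -> (k < p)%N -> 0 <= a -> 2 * a <= M - 1 ->
  n%:R * a ^+ 2 <= 1 -> 2 * delta < a ->
  exists2 Theta, G0 p M k Theta &
    ((4 * (expR 4 + 1))^-1%:E <=
     sample_prob n Theta [set x | (delta < `|est x - Theta i j|)%R])%E.
Proof.
move=> mest M1 k3 kp a0 aM na sep.
pose U := [set i; j]%SET; have U2 : (#|U| <= 2)%N by exact: card_pair_le2.
have UR : #|U|%:R <= 2 :> R by rewrite ler_nat.
have U0 : 0 <= #|U|%:R :> R by [].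
pose Om0 := PosDefMx (posdef1 R p).
pose Om (_ : unit) := PosDefMx (posdef_spike (ind R U) a0).
have entry t : Om t i j = (i == j)%:R + a.
  have iU : i \in U by rewrite !finset.inE eqxx.
  have jU : j \in U by rewrite !finset.inE eqxx orbT.
  by rewrite /= spikeE !mxE iU jU/=; ring.
apply: (@le_cam_G0 n p M k unit Om0 Om (fun _ _ => expR 4) (expR 4) delta
  (fun x Theta => `|est x - Theta i j|)) => //.
- by move=> Theta; exact: measurable_entry_loss.
- move=> x t; apply: dist_sep; rewrite entry /Om0/= mxE addrAC subrr add0r.
  by rewrite ger0_norm.
- exact: G0_1.
- by move=> t; apply: (@G0_spike _ _ M k a U) => //; nra.
- by move=> t t'; rewrite /= spike_double; apply: posdef_spike; lra.
- move=> t t'; rewrite /= spike_double !det_1Dscale_tens -[2 * a * _]mulrA.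
  rewrite dot_ind finset.setIid.
  set b := a * _; have b0 : 0 <= b by rewrite mulr_ge0.
  apply: (@le_trans _ _ (expR (b ^+ 2) ^+ n)).
    by rewrite lerXn2r ?nnegrE ?sqrtr_ge0 ?expR_ge0// sqrt_spike_ratio_le.
  rewrite -expRM_natl ler_expR /b exprMn.
  (* |U| is at most 2, so n b^2 is at most 4 n a^2, which is at most 4. *)
  apply: (@le_trans _ _ (n%:R * a ^+ 2 * 4)); last by lra.
  rewrite mulrA ler_wpM2l ?mulr_ge0 ?sqr_ge0//; nra.
- by rewrite card_unit.
by rewrite sumr_const card_prod card_unit expr1n mulr1.
Qed.

(** One spike on each diagonal position. The p diagonal pairs contribute at most p each and the
    others exactly 1, so the average over pairs is at most 2, below [expR 4]. *)
Lemma minimax_matrix_spike n p k (M a delta : R)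
    (est : n.-tuple (p.-tuple mR) -> 'M[R]_p) : matrix_estimator R n p est ->
  1 < M -> (3 <= k)%N -> (k < p)%N -> 0 <= a -> a <= M - 1 ->
  expR (n%:R * a ^+ 2) <= p%:R -> 2 * delta < a ->
  exists2 Theta, G0 p M k Theta &
    ((4 * (expR 4 + 1))^-1%:E <=
     sample_prob n Theta [set x | (delta < `|est x - (Theta : 'M[R]_p)|)%R])%E.
Proof.
move=> mest M1 k3 kp a0 aM na sep.
pose Om0 := PosDefMx (posdef1 R p).
pose Om (m : 'I_p) := PosDefMx (posdef_spike (ind R [set m]%SET) a0).
have dd (m m' : 'I_p) :
    dot (ind R [set m]%SET) (ind R [set m']%SET) = (m == m')%:R.
  rewrite dot_ind; have [<-|mm'] := eqVneq m m'.
    by rewrite finset.setIid cards1.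
  suff -> : ([set m] :&: [set m'])%SET = finset.set0 by rewrite cards0.
  apply/finset.setP => l; rewrite !finset.inE.
  by case: eqP => //= ->; rewrite (negbTE mm').
apply: (@le_cam_G0 n p M k 'I_p Om0 Om
  (fun m m' => if m == m' then expR (n%:R * a ^+ 2) else 1) (expR 4) delta
  (fun x Theta => `|est x - (Theta : 'M[R]_p)|)) => //.
- by move=> Theta; apply: measurable_mx_norm_sub => i j; exact: mest.
- move=> x m; apply: dist_sep; apply: lt_le_trans (ler_mx_norm _ m m).
  have sub1 (A : 'M[R]_p) : (A - 1%:M) m m = A m m - 1 by rewrite !mxE eqxx.
  rewrite /= sub1 spikeE !mxE finset.in_set1 eqxx/= !mulr1 addrAC subrr add0r.
  by rewrite ger0_norm.
- exact: G0_1.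
- move=> m; apply: (@G0_spike _ _ M k a [set m]%SET) => //;
    by rewrite cards1 ?mulr1.
- move=> m m'; have [<-|mm'] := eqVneq m m'.
    by rewrite /= spike_double; apply: posdef_spike; lra.
  apply: (@posdef_of_qform _ _ _ 1) => //.
    by rewrite linearB linearD/= trmx1 !tr_spike.
  move=> x; rewrite qform_addB1 !qform_spike mul1r.
  have := sqr_ge0 (dot x (ind R [set m]%SET)).
  have := sqr_ge0 (dot x (ind R [set m']%SET)); nra.
- move=> m m'; have [<-|mm'] := eqVneq m m'.
    rewrite /= spike_double !det_1Dscale_tens -[2 * a * _]mulrA.
    rewrite dd eqxx mulr1 expRM_natl.
    by rewrite lerXn2r ?nnegrE ?sqrtr_ge0 ?expR_ge0// sqrt_spike_ratio_le.
  rewrite /= spike_orthogonal ?dd ?(negbTE mm')// det_mulmx.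
  rewrite divff ?sqrtr1 ?expr1n//.
  apply: mulf_neq0; rewrite gt_eqF//; exact/posdef_det_gt0/posdef_spike.
- by rewrite card_ord (leq_ltn_trans _ kp).
rewrite card_ord -(pair_bigA _ (fun m m' : 'I_p =>
  if m == m' then expR (n%:R * a ^+ 2) else 1))/=.
apply: (@le_trans _ _ (\sum_(m < p) (p%:R + p%:R))).
  apply: ler_sum => m _; rewrite (bigD1 m)//= eqxx lerD//.
  rewrite (eq_bigr (fun=> 1)); last by move=> m' /negbTE; rewrite eq_sym => ->.
  by rewrite sumr_const ler_nat cardC1 card_ord leq_pred.
rewrite sumr_const card_ord -mulr_natr -mulrDl.
have := expR_ge1Dx (4 : R); have : 0 <= p%:R ^+ 2 :> R by exact: sqr_ge0.
by rewrite expr2; nra.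
Qed.

Lemma minimax_ge T U (E : set T) (G : set U) (c : R) (risk : T -> U -> \bar R) :
  (forall e, E e -> exists2 Theta, G Theta & (c%:E <= risk e Theta)%E) ->
  (c%:E <=
   ereal_inf [set ereal_sup [set risk e Theta | Theta in G] | e in E])%E.
Proof.
move=> h; apply: le_ereal_inf_tmp => _ [e Ee <-]; have [W GW cW] := h e Ee.
by apply: ereal_sup_ge; exists (risk e W) => //; exists W.
Qed.

End minimax.

Lemma leq_mul3_subn2 k : (3 <= k)%N -> (k <= 3 * (k - 2))%N.
Proof. lia. Qed.

(** * Choice of the parameters from M, nu and C0 *)

Section regime.
Variables (R : realType) (M nu C0 : R) (n p k : nat).
Hypotheses (M_gt1 : 1 < M) (nu_gt2 : 2 < nu) (C0_gt0 : 0 < C0).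
Hypotheses (kp : k%:R `^ nu <= p%:R) (k_ge3 : (3 <= k)%N).
Hypothesis kn : k%:R <= C0 * (n%:R / ln p%:R).

Local Notation L := (ln (p%:R : R)).

Lemma sqr_dim_le : (k ^ 2 <= p)%N.
Proof.
rewrite -(ler_nat R) natrX; apply: le_trans kp.
rewrite -powR_mulrn// ler_powR//; last exact: ltW.
by rewrite (ler_nat _ 1) (leq_trans _ k_ge3).
Qed.

Lemma dim_lt : (k < p)%N.
Proof.
apply: leq_trans sqr_dim_le.
by rewrite expnS expn1 ltn_Pmulr ?(leq_trans _ k_ge3).
Qed.

Lemma dim_gt0 : (0 < p)%N.
Proof. exact: leq_ltn_trans dim_lt. Qed.

Lemma ln_dim_gt0 : 0 < L.
Proof.
by rewrite ln_gt0// (ltr_nat _ 1) (leq_trans _ dim_lt)// ltnS (leq_trans _ k_ge3).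
Qed.

Lemma sample_gt0 : (0 < n)%N.
Proof.
rewrite lt0n; apply/eqP => n0; move: kn; rewrite n0 mul0r mulr0 leNgt.
by rewrite ltr0n (leq_trans _ k_ge3).
Qed.

Lemma rate_le : k%:R * L / n%:R <= C0.
Proof.
have n0 : 0 < n%:R :> R by rewrite ltr0n sample_gt0.
by rewrite ler_pdivrMr// -ler_pdivlMr ?ln_dim_gt0// -mulrA.
Qed.

Lemma lograte_le : L / n%:R <= C0.
Proof.
apply: le_trans rate_le; rewrite -mulrA ler_peMl ?divr_ge0 ?(ltW ln_dim_gt0)//.
by rewrite (ler_nat _ 1) (leq_trans _ k_ge3).
Qed.

Lemma ln_sparsity_le : nu * ln k%:R <= L.
Proof.
have k0 : 0 < k%:R :> R by rewrite ltr0n (leq_trans _ k_ge3).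
by rewrite -ln_powR ler_ln ?posrE ?powR_gt0// ltr0n dim_gt0.
Qed.

Let nu_gt0 : 0 < nu. Proof. exact: lt_trans nu_gt2. Qed.

Let M_gt0 : 0 < M. Proof. exact: lt_trans M_gt1. Qed.

(** The distance from the spectrum of the identity to the lower endpoint 1 / M; it is also at most
    the distance M - 1 to the upper one. *)
Definition spectral_gap : R := 1 - M^-1.

Lemma spectral_gap_gt0 : 0 < spectral_gap.
Proof. by rewrite /spectral_gap subr_gt0 invf_lt1 //. Qed.

Lemma spectral_gap_lt1 : spectral_gap < 1.
Proof. by rewrite /spectral_gap ltrBlDr ltrDl invr_gt0. Qed.

Lemma spectral_gap_le : spectral_gap <= M - 1.
Proof.
have mM : M^-1 * M = 1 by rewrite mulVf// gt_eqF.
have := spectral_gap_gt0; have := M_gt1; rewrite /spectral_gap; nra.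
Qed.

(** The remainder of p - 2 modulo s is below s, hence below s B for B the quotient, so p - 2 < 2 s
    B. *)
Lemma block_size_ge (s : nat) : (0 < s)%N -> (s + 2 <= k)%N ->
  (0 < (p - 2) %/ s)%N /\ (p <= 4 * (s * ((p - 2) %/ s)))%N.
Proof.
move=> s0 sk; have kp' := dim_lt; have k3 := k_ge3; split.
  by rewrite divn_gt0//; lia.
have := divn_eq (p - 2) s; have := ltn_pmod (p - 2) s0.
have : (0 < (p - 2) %/ s)%N by rewrite divn_gt0//; lia.
move: ((p - 2) %/ s)%N ((p - 2) %% s)%N => B r B0 rs pE.
have := leq_pmull s B0; rewrite [(s * B)%N]mulnC; move: (B * s)%N pE => Bs; lia.
Qed.

(** As k is at most p^(1 / nu), the left side is at most p^(2 / nu + t). *)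
Lemma sqr_expR_le_dim (s : nat) (t : R) : (0 < s)%N -> (s <= k)%N ->
  t <= 1 - 2 / nu -> s%:R ^+ 2 * expR (t * L) <= p%:R.
Proof.
move=> s0 sk ht; have L0 := ln_dim_gt0.
have nu0 := nu_gt0.
have k0 : 0 < k%:R :> R by rewrite ltr0n (leq_trans s0).
have kk : k%:R ^+ 2 = expR (2 * ln k%:R) :> R.
  by rewrite expRM_natl lnK ?posrE.
have pE : p%:R = expR L :> R by rewrite lnK// posrE ltr0n dim_gt0.
rewrite [leRHS]pE.
apply: (@le_trans _ _ (k%:R ^+ 2 * expR (t * L))).
  by rewrite ler_wpM2r ?expR_ge0// lerXn2r ?nnegrE// ler_nat.
rewrite kk -expRD ler_expR.
have lnk : ln k%:R <= L / nu by rewrite ler_pdivlMr// mulrC ln_sparsity_le.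
apply: (@le_trans _ _ (2 * (L / nu) + (1 - 2 / nu) * L)).
  by rewrite lerD ?ler_pM2l ?ler_wpM2r// ltW.
by rewrite le_eqVlt; apply/orP; left; apply/eqP; field; rewrite gt_eqF.
Qed.

(** The coefficient of log p / n in a^2. The first bound keeps the spectrum within [1 / M, M], using
    k log p / n <= C0; the second keeps the overlap moment bounded, and is positive because nu >
    2. *)
Definition signal : R :=
  Num.min ((spectral_gap / 5) ^+ 2 / (2 * C0)) ((1 - 2 / nu) / 4).

Lemma signal_gt0 : 0 < signal.
Proof.
rewrite /signal lt_min; have := spectral_gap_gt0 => e0; apply/andP; split.
  by rewrite divr_gt0 ?exprn_gt0 ?divr_gt0 ?mulr_gt0.
by rewrite divr_gt0// subr_gt0 ltr_pdivrMr ?mul1r.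
Qed.

Lemma minimax_entry_log_rate (delta : R) (i j : 'I_p)
    (est : n.-tuple (p.-tuple (measurableTypeR R)) -> R) :
  measurable_fun setT est ->
  delta <= signal / 7 * (k%:R * L / n%:R) ->
  exists2 Theta, G0 p M k Theta &
    ((4 * (expR 4 + 1))^-1%:E <=
     sample_prob n Theta [set x | (delta < `|est x - Theta i j|)%R])%E.
Proof.
move=> mest hd.
have n0 : 0 < n%:R :> R by rewrite ltr0n sample_gt0.
have L0 := ln_dim_gt0; have t0 := signal_gt0; have rle := rate_le.
have Ln0 : 0 < L / n%:R by rewrite divr_gt0.
(* Two places in each column are reserved for [i] and [j]. *)
pose s := (k - 2)%N; have s0 : (0 < s)%N by rewrite subn_gt0.
have sk : (s + 2 <= k)%N by rewrite subnK// ltnW.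
have sk' : (s <= k)%N by exact: leq_subr.
have ks : k%:R <= 3 * s%:R :> R.
  by rewrite -natrM ler_nat leq_mul3_subn2.
have skR : s%:R <= k%:R :> R by rewrite ler_nat.
have k0 : 0 < k%:R :> R by rewrite ltr0n (leq_trans s0).
have [B0 pB] := block_size_ge s0 sk.
pose a : R := Num.sqrt (signal * (L / n%:R)).
have a2 : a ^+ 2 = signal * (L / n%:R) by rewrite sqr_sqrtr// mulr_ge0// ltW.
have rate0 : 0 < k%:R * L / n%:R by rewrite -mulrA mulr_gt0.
apply: (@minimax_entry_overlap _ n p k M a delta i j s ((p - 2) %/ s)) => //.
- exact: dim_lt.
- have p2 : (2 <= p)%N by rewrite (leq_trans _ dim_lt)// ltnW// ltnW.
  by rewrite -[leqRHS](subnK p2) leq_add2r mulnC leq_divM.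
- exact: sqrtr_ge0.
- rewrite -/spectral_gap a2.
  apply: (@le_trans _ _ (2 * signal * C0)).
    apply: (@le_trans _ _ (2 * signal * (k%:R * L / n%:R))); last first.
      by rewrite ler_wpM2l// mulr_ge0// ltW.
    rewrite [leLHS](_ : _ = 2 * signal * (L / n%:R) * s%:R); last by ring.
    rewrite [leRHS](_ : _ = 2 * signal * (L / n%:R) * k%:R); last by ring.
    by rewrite ler_wpM2l// ltW//; do 2 apply: mulr_gt0 => //.
  rewrite [leLHS](_ : _ = signal * (2 * C0)); last by ring.
  rewrite -ler_pdivlMr ?mulr_gt0//.
  by rewrite /signal ge_min lexx.
- have -> : n%:R * (4 * a ^+ 2) = 4 * signal * L.
    by rewrite a2; field; rewrite gt_eqF.
  have s0R : 0 < s%:R :> R by rewrite ltr0n.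
  (* After multiplication by s the claim becomes s^2 p^(4 signal) <= 4 s B, and p lies between the
     two sides. *)
  rewrite -(ler_pM2l s0R) mulrA -expr2.
  apply: (@le_trans _ _ p%:R).
    apply: sqr_expR_le_dim => //.
    by rewrite mulrC -ler_pdivlMr// /signal ge_min lexx orbT.
  by rewrite mulrCA -!natrM ler_nat.
(* The constant 7 works since k <= 3 s gives 2 k / 7 <= 6 s / 7 < s. *)
rewrite a2; apply: (@le_lt_trans _ _ (2 * (signal / 7 * (k%:R * L / n%:R)))).
  by rewrite ler_pM2l.
rewrite [ltLHS](_ : _ = signal * (L / n%:R) * (2 / 7 * k%:R)); last first.
  by field; rewrite gt_eqF.
rewrite ltr_pM2l; last exact: mulr_gt0.
move: (k%:R) (s%:R : R) ks k0 => x y; lra.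
Qed.

Lemma minimax_entry_parametric_rate (delta : R) (i j : 'I_p)
    (est : n.-tuple (p.-tuple (measurableTypeR R)) -> R) :
  measurable_fun setT est ->
  delta <= spectral_gap / 6 * Num.sqrt (1 / n%:R) ->
  exists2 Theta, G0 p M k Theta &
    ((4 * (expR 4 + 1))^-1%:E <=
     sample_prob n Theta [set x | (delta < `|est x - Theta i j|)%R])%E.
Proof.
move=> mest hd.
have n0 : 0 < n%:R :> R by rewrite ltr0n sample_gt0.
have e0 := spectral_gap_gt0; have e1 := spectral_gap_lt1.
have r0 : 0 < Num.sqrt (1 / n%:R) :> R by rewrite sqrtr_gt0 divr_gt0.
have r1 : Num.sqrt (1 / n%:R) <= 1 :> R.
  rewrite -[leRHS]sqrtr1 ler_wsqrtr// ler_pdivrMr// mul1r (ler_nat _ 1).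
  exact: sample_gt0.
have r2 : n%:R * Num.sqrt (1 / n%:R) ^+ 2 = 1 :> R.
  by rewrite sqr_sqrtr ?divr_ge0//; field; rewrite gt_eqF.
have em := spectral_gap_le.
(* With this amplitude 2 a <= M - 1 and n a^2 <= 1, and 2 / 6 < 1 / 2 gives the strict
   separation. *)
apply: (@minimax_entry_spike _ n p k M
  (spectral_gap / 2 * Num.sqrt (1 / n%:R))) => //.
- exact: dim_lt.
- by rewrite mulr_ge0 ?sqrtr_ge0 ?divr_ge0// ltW.
- apply: le_trans em; move: (Num.sqrt _) r0 r1 => r *; nra.
- rewrite exprMn mulrCA r2 mulr1; nra.
- apply: (@le_lt_trans _ _ (2 * (spectral_gap / 6 * Num.sqrt (1 / n%:R)))).
    by rewrite ler_pM2l.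
  move: (Num.sqrt _) r0 => r *; nra.
Qed.

Lemma minimax_matrix_rate (delta : R)
    (est : n.-tuple (p.-tuple (measurableTypeR R)) -> 'M[R]_p) :
  matrix_estimator R n p est ->
  delta <= spectral_gap / (1 + Num.sqrt C0) / 3 * Num.sqrt (L / n%:R) ->
  exists2 Theta, G0 p M k Theta &
    ((4 * (expR 4 + 1))^-1%:E <=
     sample_prob n Theta [set x | (delta < `|est x - (Theta : 'M[R]_p)|)%R])%E.
Proof.
move=> mest hd.
have n0 : 0 < n%:R :> R by rewrite ltr0n sample_gt0.
have e0 := spectral_gap_gt0; have e1 := spectral_gap_lt1.
have em := spectral_gap_le.
have L0 := ln_dim_gt0.
have c0 : 0 <= Num.sqrt C0 by exact: sqrtr_ge0.
have r0 : 0 < Num.sqrt (L / n%:R) by rewrite sqrtr_gt0 divr_gt0.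
have rc : Num.sqrt (L / n%:R) <= Num.sqrt C0 by rewrite ler_wsqrtr// lograte_le.
have r2 : n%:R * Num.sqrt (L / n%:R) ^+ 2 = L.
  by rewrite sqr_sqrtr ?divr_ge0 ?(ltW L0)//; field; rewrite gt_eqF.
(* The denominator absorbs sqrt (log p / n) <= sqrt C0, so the spike b sqrt (log p / n) stays below
   M - 1; also b <= 1 gives n a^2 <= log p. *)
set b := spectral_gap / (1 + Num.sqrt C0) in hd.
have bE : b * (1 + Num.sqrt C0) = spectral_gap.
  by rewrite /b divfK// gt_eqF// ltr_wpDr.
have b0 : 0 < b by rewrite divr_gt0// ltr_wpDr.
apply: (@minimax_matrix_spike _ n p k M (b * Num.sqrt (L / n%:R))) => //.
- exact: dim_lt.
- by rewrite mulr_ge0// ltW.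
- apply: le_trans em; rewrite -bE ler_pM2l//; lra.
- rewrite exprMn mulrCA r2 -[leRHS]lnK ?posrE ?ltr0n ?dim_gt0// ler_expR.
  rewrite ler_piMl ?(ltW L0)//.
  have : b <= 1 by move: (Num.sqrt C0) c0 bE => c *; nra.
  nra.
- apply: (@le_lt_trans _ _ (2 * (b / 3 * Num.sqrt (L / n%:R)))).
    by rewrite ler_pM2l.
  move: (Num.sqrt (L / _)) r0 => r *; nra.
Qed.

End regime.

Theorem theorem5 (R : realType) (M nu C0 : R) :
  1 < M -> 2 < nu -> 0 < C0 ->
  exists c1 c2 C1 C2 C1' C2' : R,
    [/\ 0 < c1, 0 < c2, 0 < C1 & 0 < C2] /\ (0 < C1' /\ 0 < C2') /\
    forall n p k : nat,
      k%:R `^ nu <= p%:R ->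
      (3 <= k)%N -> k%:R <= C0 * (n%:R / ln p%:R) ->
      (forall i j : 'I_p,
        (c1%:E < ereal_inf
          [set ereal_sup
            [set sample_prob n Omega
              [set x | (Order.max (C1 * (k%:R * ln p%:R / n%:R))
                                 (C2 * Num.sqrt (1 / n%:R))
                       < `|est x - Omega i j|)%R]
            | Omega in G0 p M k]
          | est in [set: entry_estimator R n p]])%E) /\
      (c2%:E < ereal_inf
        [set ereal_sup
          [set sample_prob n Omega
            [set x | (Order.max (C1' * (k%:R * ln p%:R / n%:R))
                               (C2' * Num.sqrt (ln p%:R / n%:R))
                     < `|est x - (Omega : 'M[R]_p)|)%R]
          | Omega in G0 p M k]
        | est in matrix_estimator R n p])%E.
Proof.
move=> M1 nu2 C00.
pose c : R := (4 * (expR 4 + 1))^-1.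
have c0 : 0 < c by rewrite invr_gt0 mulr_gt0// addr_gt0// expR_gt0.
(* The risk bounds obtained are non-strict with constant [c]; halving it makes them strict. *)
have c2c : ((c / 2)%:E < c%:E)%E.
  by rewrite lte_fin ltr_pdivrMr// ltr_pMr// ltr1n.
have t0 := signal_gt0 M1 nu2 C00; have e0 := spectral_gap_gt0 M1.
have s0 : 0 < 1 + Num.sqrt C0 by rewrite ltr_wpDr// sqrtr_ge0.
exists (c / 2), (c / 2), (signal M nu C0 / 7), (spectral_gap M / 6),
  (signal M nu C0 / 7),
  (spectral_gap M / (1 + Num.sqrt C0) / 3).
split; first by split; rewrite ?divr_gt0.
split; first by split; rewrite ?divr_gt0.
move=> n p k kp k3 kn; split=> [i j|]; apply: lt_le_trans c2c _.
  apply: minimax_ge => est _.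
  have mest : measurable_fun setT est by exact: measurable_funP.
  (* The maximum equals one of its two rates, and the family adapted to that rate is used. *)
  have [_|_] := leP (signal M nu C0 / 7 * _).
    exact: (minimax_entry_parametric_rate M1 nu2 kp k3 kn i j mest).
  exact: (minimax_entry_log_rate M1 nu2 C00 kp k3 kn i j mest).
apply: minimax_ge => est mest.
have [_|_] := leP (signal M nu C0 / 7 * _).
  exact: (minimax_matrix_rate M1 nu2 kp k3 kn mest).
(* For the k log p / n rate the maximum norm dominates the error of any single entry, so the
   entrywise bound at ([i0], [i0]) suffices. *)
pose i0 := Ordinal (dim_gt0 nu2 kp k3).
set delta := signal M nu C0 / 7 * _.
have [W GW cW] := minimax_entry_log_rate M1 nu2 C00 kp k3 kn i0 i0
  (mest i0 i0) (lexx delta).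
exists W => //; apply: le_trans cW _; apply: le_measure.
- rewrite inE; apply: measurable_superlevel.
  exact: (measurable_entry_loss _ (mest i0 i0)).
- rewrite inE; apply: measurable_superlevel.
  by apply: measurable_mx_norm_sub => i j; exact: mest.
move=> x; rewrite /= => h; apply: lt_le_trans h _.
by apply: le_trans (ler_mx_norm _ i0 i0); rewrite !mxE.
Qed.
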